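(* Let $(X,(p_j)_{j\ge 1})$ be a Fréchet space. If for every $j\ge 1$, $\ker p_{j+1}$ is a subspace of infinite codimension in $\ker p_j$, then $X$ does not satisfy the Hereditary Invariant Subset Property.
   Context: A Fréchet space $(X,(p_j)_{j\ge1})$ (over $\mathbb{K}=\mathbb{R}$ or $\mathbb{C}$) is a topological vector space whose topology is induced by a non-decreasing and separating sequence of seminorms $(p_j)_{j\ge 1}$ such that the metric $d(x,y)=\sum_{j\ge 1}2^{-j}\min\{1,p_j(x-y)\}$ is complete; $(p_j)$ is always assumed non-decreasing and separating. A continuous linear operator $T:Y\to Y$ on a Fréchet space $Y$ possesses a non-trivial invariant subset if there exists a non-empty closed subset $M$ of $Y$, different from $\{0\}$ and $Y$, such that $TM\subset M$. The space $Y$ satisfies the Invariant Subset Property if every continuous linear operator on $Y$ possesses a non-trivial invariant subset. The space $X$ satisfies the Hereditary Invariant Subset Property if every closed infinite-dimensional subspace of $X$ satisfies the Invariant Subset Property. *)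

(* Defs.v *)
From HB Require Import structures.
From mathcomp Require Import all_boot all_order all_algebra.
From mathcomp Require Import complex.
From mathcomp Require Import all_classical all_reals all_analysis.
Set Implicit Arguments.
Unset Strict Implicit.
Unset Printing Implicit Defensive.
Import Order.TTheory GRing.Theory Num.Theory.
Import numFieldNormedType.Exports.
Local Open Scope classical_set_scope.
Local Open Scope ring_scope.

Inductive scalar_kind := RealScalars | ComplexScalars.

Definition scalars (R : realType) (k : scalar_kind) : numFieldType :=
  match k with RealScalars => R | ComplexScalars => R[i]%C end.

(* The norm of [R[i]] takes its values in [R[i]], whereas seminorms are
   [R]-valued; [normc] is the same norm seen as an element of [R]. *)
Definition modulus (R : realType) (k : scalar_kind) : scalars R k -> R :=
  match k with
  | RealScalars => fun a : R => `|a|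
  | ComplexScalars => fun a : R[i]%C => ComplexField.Normc.normc a
  end.

(* For subspaces [W] of [U]: the quotient [U / W] is not spanned by the classes
   of finitely many vectors of [U]. *)
Definition infinite_codim (K : numFieldType) (V : lmodType K) (W U : set V) :=
  ~ exists (n : nat) (v : 'I_n -> V), (forall i, U (v i)) /\
      forall u, U u -> exists a : 'I_n -> K, W (u - \sum_i a i *: v i).

Definition infinite_dimensional (K : numFieldType) (V : lmodType K) :=
  infinite_codim [set (0 : V)] [set: V].

Section Subspace.
Context (K : numFieldType) (X : topologicalLmodType K).

(* A linear subspace [Y] as a topological vector space in its own right, with
   the topology induced by [X]. *)
Definition subspace_type (Y : submodClosed X) : Type := {x : X | x \in Y}.

Variable Y : submodClosed X.
Local Notation sY := (subspace_type Y).
Let incl : sY -> X := val.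

HB.instance Definition _ := SubChoice.on sY.
HB.instance Definition _ := [SubChoice_isSubLmodule of sY by <:].
HB.instance Definition _ := Topological.copy sY (initial_topology incl).

Let inclD (x y : sY) : incl (x + y) = incl x + incl y.
Proof. exact: (raddfD (val : sY -> X)). Qed.

Let inclZ (a : K) (x : sY) : incl (a *: x) = a *: incl x.
Proof. exact: (linearZ_LR (val : {linear sY -> X})). Qed.

Let cvg_incl (F : set_system sY) (y : sY) :
  Filter F -> incl @ F --> incl y -> F --> y.
Proof.
move=> FF Fy A [_ [[B oB <-] By BA]].
by apply: (filterS BA); apply: Fy; exact: open_nbhs_nbhs.
Qed.

Let incl_continuous : continuous incl.
Proof. exact: initial_continuous. Qed.

Let add_continuous : continuous (fun x : sY * sY => x.1 + x.2).
Proof.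
move=> x; apply: cvg_incl; rewrite inclD => A.
move=> /(@add_continuous _ (incl x.1, incl x.2))[[B1 B2] /= [nB1 nB2] BA].
exists (incl @^-1` B1, incl @^-1` B2); first by split; exact: incl_continuous.
by move=> z [? ?] /=; rewrite inclD; exact: (BA (incl z.1, incl z.2)).
Qed.

HB.instance Definition _ :=
  PreTopologicalNmodule_isTopologicalNmodule.Build sY add_continuous.

Let scale_continuous : continuous (fun z : K^o * sY => z.1 *: z.2).
Proof.
move=> x; apply: cvg_incl; rewrite inclZ => A.
move=> /(@scale_continuous _ _ (x.1, incl x.2))[[B1 B2] /= [nB1 nB2] BA].
exists (B1, incl @^-1` B2); first by split=> //; exact: incl_continuous.
by move=> z [? ?] /=; rewrite inclZ; exact: (BA (z.1, incl z.2)).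
Qed.

HB.instance Definition _ :=
  TopologicalNmodule_isTopologicalLmodule.Build K sY scale_continuous.

End Subspace.

Definition has_nontrivial_invariant_subset (K : numFieldType)
    (Y : topologicalLmodType K) (T : Y -> Y) :=
  exists M : set Y,
    [/\ M !=set0, closed M, M <> [set 0], M <> [set: Y] & T @` M `<=` M].

Definition invariant_subset_property (K : numFieldType)
    (Y : topologicalLmodType K) :=
  forall T : {linear Y -> Y}, continuous T -> has_nontrivial_invariant_subset T.

Definition hereditary_invariant_subset_property (K : numFieldType)
    (X : topologicalLmodType K) :=
  forall Y : submodClosed X, closed [set x : X | x \in Y] ->
    infinite_dimensional (subspace_type Y) ->
    invariant_subset_property (subspace_type Y).

Section Frechet.
Context (R : realType) (k : scalar_kind) (X : topologicalLmodType (scalars R k)).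

Record is_seminorm (q : X -> R) : Prop := {
  seminorm_ge0 : forall x, 0 <= q x;
  seminormD : forall x y, q (x + y) <= q x + q y;
  seminormZ : forall (a : scalars R k) x, q (a *: x) = modulus a * q x }.

Definition seminorm_ker (q : X -> R) : set X := [set x | q x = 0].

(* A sequence of seminorms (p_j), j >= 1, is indexed from 0: [p j] stands for
   p_{j+1}, whose weight in the distance is 2^-(j+1). *)
Definition frechet_dist (p : nat -> X -> R) (x y : X) : R :=
  limn (series (fun j => 2^-1 ^+ j.+1 * Num.min 1 (p j (x - y)))).

Definition frechet_complete (p : nat -> X -> R) : Prop :=
  forall u : nat -> X,
    (forall e : R, 0 < e -> exists N, forall m n, (N <= m)%N -> (N <= n)%N ->
       frechet_dist p (u m) (u n) < e) ->
    exists l : X, frechet_dist p (u n) l @[n --> \oo] --> (0 : R).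

Record is_frechet (p : nat -> X -> R) : Prop := {
  frechet_seminorm : forall j, is_seminorm (p j);
  frechet_nondecreasing : forall j x, p j x <= p j.+1 x;
  frechet_separating : forall x, (forall j, p j x = 0) -> x = 0;
  frechet_topology : forall x : X,
    nbhs x = filter_from [set ne : nat * R | 0 < ne.2]
      (fun ne => [set y | forall j, (j <= ne.1)%N -> p j (y - x) < ne.2]);
  frechet_is_complete : frechet_complete p }.

End Frechet.

(* Main.v *)
Require Import Defs.
From HB Require Import structures.
From mathcomp Require Import all_boot all_order all_algebra.
From mathcomp Require Import complex.
From mathcomp Require Import all_classical all_reals all_analysis.
From mathcomp Require Import ring lra zify.
Set Implicit Arguments.
Unset Strict Implicit.
Unset Printing Implicit Defensive.
Import Order.TTheory GRing.Theory Num.Theory.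
Import numFieldNormedType.Exports.
Local Open Scope classical_set_scope.
Local Open Scope ring_scope.

(** A closed subspace and an operator on it are constructed such that every nonzero
vector has a dense orbit; a closed invariant set containing a nonzero vector is
then the whole space.

The operator is the multiplication by ['X]: polynomials are mapped linearly to
vectors of [X] by a map [realize], the subspace is the closure of the image, and
the multiplication by ['X] extends to it by continuity.  The freedom is in the
choice of the seminorms [q j f = p j (realize f)] on polynomials.  They are
prescribed through a basis [fresh n] of the polynomials, monic of degree [n].

Each index [n] has a level, and [fresh n] is mapped into the kernel of the
seminorms up to its level.  More precisely the image of [fresh n] is a series of
multiples [lam j n *: e j n], for [j] at least the level of [n], where [e j n] is
in [ker (p j)] and these vectors have biorthogonal forms [phi j n], bounded by
[p j.+1].  Such a system exists because [ker (p j.+1)] has infinite codimension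
in [ker (p j)], and by the Hahn-Banach theorem.  The [n]-th coordinate
multiplied by [lam j n] is then bounded by [p j.+1].  As [q j] depends only on
the rows [lam i] with [i < j], the weights [lam j n] can be taken as large as
desired compared with what [q j] gives on any finitely many vectors, at all
indices [n] of level at most [j].  At the other indices the quantities to be
estimated vanish, because shifts lower the level slowly ([shift_fresh]).  Thus
the contribution of the late coordinates of a vector is always negligible.

The basis is organized in phases.  Phase [i] treats a task, namely a seminorm
[J i] and a polynomial [g i]; every pair with [g i] in a countable dense set of
polynomials occurs infinitely often.  There is a time [m] such that [fresh] is
['X^(m + l) - 'X^l * g i], of level [J i], for small [l], and later a long window
of powers of ['X] of level [J i].  This has two consequences, with [T] the
operator and [x] a vector of the subspace, up to small errors for the seminorm
[p (J i)].

- [return_near]: [T^m x] is close to [g i (T) x].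

- [pursuit_near]: if [x] is nonzero then [P (T) x] is close to the vector
  [realize (g i)] for some polynomial [P].  Indeed an initial part of [x] is,
  except for small coefficients, a polynomial ['X^r * c] with nonzero [c`_0], and
  for [P] one takes ['X^(m - r)] times a truncation of the inverse power series of
  [c]: the product is ['X^m], which is seen as [g i], plus terms that are in the
  window.  The errors on later coordinates are
  negligible because [P] can be bounded before the weights at these coordinates
  are chosen; that is the object of [pursuit_cascade].

Hence any vector of the subspace is close to some [P (T) x], then to some
[g i (T) x], then to some [T^m x]: this is [orbit_dense]. *)

(** * The modulus of a scalar *)

Section Modulus.
Context (R : realType) (k : scalar_kind).
Local Notation K := (scalars R k).
Implicit Types a b : K.

Lemma modulus_ge0 a : 0 <= modulus a.
Proof.
case: k a => /= a; first exact: normr_ge0.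
by case: a => x y; exact: sqrtr_ge0.
Qed.

Lemma modulusM a b : modulus (a * b) = modulus a * modulus b.
Proof. by case: k a b => /= a b; [exact: normrM|exact: ComplexField.Normc.normcM]. Qed.

Lemma modulusD a b : modulus (a + b) <= modulus a + modulus b.
Proof. by case: k a b => /= a b; [exact: ler_normD|exact: le_normcD]. Qed.

Lemma modulus_eq0 a : (modulus a == 0) = (a == 0).
Proof.
case: k a => /= a; first exact: normr_eq0.
by apply/eqP/eqP => [/ComplexField.Normc.eq0_normc|->//]; last exact: ComplexField.Normc.normc0.
Qed.

Lemma modulus0 : modulus (0 : K) = 0.
Proof. by apply/eqP; rewrite modulus_eq0. Qed.

Lemma modulus1 : modulus (1 : K) = 1.
Proof. by case: k => /=; [exact: normr1|exact: ComplexField.Normc.normc1]. Qed.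

Lemma modulusN a : modulus (- a) = modulus a.
Proof. by case: k a => /= a; [exact: normrN|exact: normcN]. Qed.

Lemma modulusB a b : modulus (a - b) <= modulus a + modulus b.
Proof. by rewrite -(modulusN b) modulusD. Qed.

Lemma modulus_gt0 a : (0 < modulus a) = (a != 0).
Proof. by rewrite lt_def modulus_ge0 andbT modulus_eq0. Qed.

Lemma modulusV a : modulus a^-1 = (modulus a)^-1.
Proof. by case: k a => /= a; [exact: normfV|exact: ComplexField.Normc.normcV]. Qed.

Lemma modulus_nat n : modulus (n%:R : K) = n%:R.
Proof.
case: k => /=; first by rewrite normr_nat.
by rewrite (@normcMn R 1 n) ComplexField.Normc.normc1.
Qed.

Lemma modulus_sum I (r : seq I) (P : pred I) (F : I -> K) :
  modulus (\sum_(i <- r | P i) F i) <= \sum_(i <- r | P i) modulus (F i).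
Proof.
elim/big_rec2: _ => [|i x y _ h]; first by rewrite modulus0.
by apply: le_trans (modulusD _ _) _; rewrite lerD2l.
Qed.

(** The points with rational coordinates are enumerated through their codes. *)
Lemma scalars_separable : exists al : nat -> K,
  forall (a : K) (e : R), 0 < e -> exists n, modulus (a - al n) < e.
Proof.
have dense (x e : R) : 0 < e -> exists q : rat, `|x - ratr q| < e.
  move=> e0; have [|q] := @rat_in_itvoo R (x - e) (x + e); first lra.
  by rewrite in_itv /= => /andP[h1 h2]; exists q; rewrite ltr_distlC; lra.
case: k => /=.
  exists (fun n => if unpickle n is Some q then ratr q else 0) => a e e0.
  by have [q hq] := dense a e e0; exists (pickle q); rewrite pickleK.
exists (fun n => if unpickle n is Some (q1, q2) then (ratr q1 +i* ratr q2)%C else 0).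
move=> [x y] e e0.
have e2 : 0 < e / 2 by lra.
have [q1 h1] := dense x _ e2; have [q2 h2] := dense y _ e2.
exists (pickle (q1, q2)); rewrite pickleK.
have -> : (x +i* y)%C - (ratr q1 +i* ratr q2)%C
   = ((x - ratr q1) +i* 0)%C + (0 +i* (y - ratr q2))%C.
  by congr (_ +i* _)%C; rewrite ?addr0 ?add0r.
apply: le_lt_trans (le_normcD _ _) _ => /=.
by rewrite !expr0n /= addr0 add0r !sqrtr_sqr; lra.
Qed.

End Modulus.

(** * Seminorms and truncated inverses of polynomials *)

Section Seminorm.
Context (R : realType) (k : scalar_kind) (V : lmodType (scalars R k)).

(** Seminorms on bare modules: they will live on spaces of polynomials as well as
on [X]. *)
Definition seminorm (q : V -> R) : Prop :=
  (forall x y, q (x + y) <= q x + q y) /\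
  (forall a x, q (a *: x) = modulus a * q x).

Variable q : V -> R.
Hypothesis hq : seminorm q.

Lemma semiD x y : q (x + y) <= q x + q y. Proof. by case: hq. Qed.

Lemma semiZ a x : q (a *: x) = modulus a * q x. Proof. by case: hq. Qed.

Lemma semi0 : q 0 = 0.
Proof. by rewrite -(scale0r (0 : V)) semiZ modulus0 mul0r. Qed.

Lemma semiN x : q (- x) = q x.
Proof. by rewrite -scaleN1r semiZ modulusN modulus1 mul1r. Qed.

Lemma semiB x y : q (x - y) <= q x + q y.
Proof. by rewrite -(semiN y) semiD. Qed.

Lemma semi_ge0 x : 0 <= q x.
Proof. have := semiB x x; rewrite subrr semi0; lra. Qed.

Lemma semiC x y : q (x - y) = q (y - x).
Proof. by rewrite -semiN opprB. Qed.

Lemma semi_tri z x y : q (x - y) <= q (x - z) + q (z - y).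
Proof. by apply: le_trans (semiD _ _); rewrite addrA subrK. Qed.

Lemma semi_sum I (r : seq I) (P : pred I) (F : I -> V) :
  q (\sum_(i <- r | P i) F i) <= \sum_(i <- r | P i) q (F i).
Proof.
elim/big_rec2: _ => [|i x y _ h]; first by rewrite semi0.
by apply: le_trans (semiD _ _) _; rewrite lerD2l.
Qed.

Lemma semi_eq x y : q (x - y) = 0 -> q x = q y.
Proof.
move=> h; apply/eqP; rewrite eq_le; apply/andP; split.
  by have := semiD (x - y) y; rewrite subrK h add0r.
by have := semiD (y - x) x; rewrite subrK -semiC h add0r.
Qed.

End Seminorm.

Section Pursuit.
Context (R : realType) (k : scalar_kind).
Local Notation K := (scalars R k).
Implicit Types (f g p c P : {poly K}).

Lemma modulus_coefM (n : nat) (A B : R) p c : (size p + size c <= n)%N ->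
  (forall i, modulus p`_i <= A) -> (forall i, modulus c`_i <= B) ->
  forall i, modulus (p * c)`_i <= n%:R * (A * B).
Proof.
move=> hs hA hB i.
have A0 : 0 <= A by apply: le_trans (hA 0%N); exact: modulus_ge0.
have B0 : 0 <= B by apply: le_trans (hB 0%N); exact: modulus_ge0.
have [ni|ni] := leqP n i.
  rewrite nth_default ?modulus0 ?mulr_ge0//.
  apply: leq_trans (size_polyMleq _ _) _; apply: leq_trans ni.
  by apply: leq_trans hs; exact: leq_pred.
rewrite coefM; apply: le_trans (modulus_sum _ _ _) _.
apply: (@le_trans _ _ (\sum_(j < i.+1) A * B)).
  by apply: ler_sum => j _; rewrite modulusM ler_pM ?modulus_ge0.
by rewrite sumr_const card_ord -[leLHS]mulr_natl ler_wpM2r ?mulr_ge0// ler_nat.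
Qed.

Lemma semi_poly (q : {poly K} -> R) : seminorm q -> forall n f, (size f <= n)%N ->
  q f <= \sum_(i < n) modulus f`_i * q 'X^i.
Proof.
move=> hq n f hn; rewrite -{1}(coefK f) poly_def.
apply: le_trans (semi_sum hq _ _ _) _.
under eq_bigr do rewrite (semiZ hq).
rewrite (big_ord_widen n (fun i => modulus f`_i * q 'X^i) hn) big_mkcond /=.
apply: ler_sum => i _; case: ifP => // _.
by rewrite mulr_ge0 ?modulus_ge0 ?(semi_ge0 hq).
Qed.

(** The coefficients of a truncated inverse power series are obtained one after
the other by dividing by the constant term only, whence a bound depending on a
lower bound of the latter. *)
Lemma truncated_inverse (d : R) (H : nat) : 0 < d -> exists2 B, 0 <= B &
  forall c, d <= modulus c`_0 -> (forall i, modulus c`_i <= 1) ->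
  exists p, [/\ (size p <= H)%N, forall i, modulus p`_i <= B &
    forall i, (i < H)%N -> (p * c)`_i = (i == 0%N)%:R].
Proof.
move=> d0; elim: H => [|H [B B0 IH]].
  by exists 0 => // c _ _; exists 0; split; rewrite ?size_poly0// => i; rewrite coef0 modulus0.
have M0 : 0 <= (1 + H.+1%:R * B) / d by rewrite divr_ge0 ?(ltW d0)// addr_ge0 ?mulr_ge0.
exists (B + (1 + H.+1%:R * B) / d); first by rewrite addr_ge0.
move=> c c0 c1; have [p [sp pB pc]] := IH c c0 c1.
have c00 : c`_0 != 0 by rewrite -modulus_gt0 (lt_le_trans d0).
pose s := ((H == 0%N)%:R - (p * c)`_H) / c`_0.
exists (p + s *: 'X^H); split.
- apply: leq_trans (size_polyD _ _) _; rewrite geq_max (leq_trans sp)//=.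
  by apply: leq_trans (size_scale_leq _ _) _; rewrite size_polyXn.
- move=> i; rewrite coefD coefZ coefXn; apply: le_trans (modulusD _ _) _.
  apply: lerD => //.
  have s1 : modulus s <= (1 + H.+1%:R * B) / d.
    rewrite modulusM modulusV ler_pM ?modulus_ge0 ?invr_ge0 ?modulus_ge0//.
      apply: le_trans (modulusB _ _) _; apply: lerD.
        by rewrite modulus_nat; case: (H == 0%N); rewrite ?lexx ?ler01.
      rewrite coefM; apply: le_trans (modulus_sum _ _ _) _.
      apply: (@le_trans _ _ (\sum_(j < H.+1) B)).
        by apply: ler_sum => j _; rewrite modulusM -[leRHS]mulr1 ler_pM ?modulus_ge0.
      by rewrite sumr_const card_ord mulr_natl.
    by rewrite lef_pV2// posrE (lt_le_trans d0).
  by case: (i == H); rewrite ?mulr1// mulr0 modulus0.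
- move=> i; rewrite mulrDl coefD -scalerAl coefZ coefXnM ltnS leq_eqVlt.
  case: ltnP => [iH _|_]; first by rewrite mulr0 addr0 pc.
  case/orP => [/eqP->|//].
  by rewrite subnn /s mulfVK// addrC subrK.
Qed.

(** Below, ['X^m] is indistinguishable from the target [g], and ['X^(m + H)] starts
a window of [t] powers that vanish for the seminorm [q]. *)
Variables (q : {poly K} -> R) (hq : seminorm q).
Variables (t m H : nat) (g : {poly K}).
Hypotheses (tm : (t <= m)%N) (H0 : (0 < H)%N).
Hypothesis return_m : q ('X^m - g) = 0.
Hypothesis quiet_m : forall y, (y < t)%N -> q 'X^(m + H + y) = 0.

(** If [f] is dominated by its coefficient [f`_r] among the first ones, then [P]
is ['X^(m - r)] times a truncated inverse of [f / 'X^r]: up to a term killed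
by the quiet window, [P * f] is ['X^m].  The smaller coefficients below the
index [r] give an error, which is negligible when they lie below a threshold
depending on the size of the inverse; otherwise a smaller [r] is tried, with
that threshold as new lower bound. *)
Lemma pursuit_cascade (e : R) : 0 < e -> forall r, (r <= t)%N -> forall d, 0 < d ->
  exists2 B, 0 <= B & forall f, (size f <= t)%N -> (forall i, modulus f`_i <= 1) ->
    (exists2 n, (n < r)%N & d <= modulus f`_n) ->
  exists P, [/\ (size P <= m + H)%N, forall i, modulus P`_i <= B & q (P * f - g) <= e].
Proof.
move=> e0; elim => [|r IH] rt d d0.
  by exists 0 => // f _ _ [n].
have [B1 B10 hB1] := truncated_inverse H d0.
pose A := \sum_(i < m + H + t) q 'X^i.
have A0 : 0 <= A by apply: sumr_ge0 => i _; exact: semi_ge0.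
pose C := (H + t)%:R * B1 * A.
have C0 : 0 <= C by rewrite !mulr_ge0.
(* The threshold below which the coefficients of index less than [r] are harmless. *)
pose d' := e / (1 + C).
have d'0 : 0 < d' by rewrite divr_gt0//; lra.
have d''0 : 0 < Num.min d d' by rewrite lt_min d0.
have [B2 B20 hB2] := IH (ltnW rt) _ d''0.
exists (B1 + B2); first by lra.
move=> f sf f1 [n nr dn].
have [[n' n'r dn']|small] :=
    pselect (exists2 n', (n' < r)%N & Num.min d d' <= modulus f`_n').
  have [|P [sP PB Pe]] := hB2 f sf f1; first by exists n'.
  by exists P; split=> // i; apply: le_trans (PB i) _; lra.
have {}small i : (i < r)%N -> modulus f`_i < Num.min d d'.
  by move=> ir; rewrite ltNge; apply/negP => h; apply: small; exists i.
have {n nr dn}dr : d <= modulus f`_r.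
  move: nr; rewrite ltnS leq_eqVlt => /orP[/eqP<-//|/small].
  by rewrite lt_min ltNge dn.
pose c := drop_poly r f.
have [||p [sp pB pc]] := hB1 c.
- by rewrite coef_drop_poly.
- by move=> i; rewrite coef_drop_poly.
have rm : (r <= m)%N by rewrite ltnW// (leq_trans rt).
exists ('X^(m - r) * p); split.
- apply: leq_trans (size_polyMleq _ _) _; rewrite size_polyXn.
  by move: sp rm H0; lia.
- move=> i; rewrite coefXnM; case: ifP => _; first by rewrite modulus0; lra.
  by apply: le_trans (pB _) _; lra.
(* [h] is the error coming from the low coefficients, [w] the part of [p * c]
   pushed into the window. *)
pose h := p * take_poly r f.
pose w := drop_poly H (p * c).
have sc : (size c <= t - r)%N by rewrite size_drop_poly leq_sub2r.
have pcE : p * c = 1 + w * 'X^H.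
  rewrite -[LHS](poly_take_drop H); congr (_ + _); apply/polyP => i.
  rewrite coef_take_poly coef1; case: ifP => [/pc->//|/negbT].
  by rewrite -leqNgt; case: i => // ; rewrite leqNgt H0.
have sw : (size w <= t)%N.
  rewrite size_drop_poly; have := size_polyMleq p c.
  by move: sp sc; lia.
have fE : 'X^(m - r) * p * f - g = 'X^(m - r) * h + (('X^m - g) + 'X^(m + H) * w).
  have -> : 'X^(m - r) * p * f - g = 'X^(m - r) * h + ('X^(m - r) * 'X^r * (p * c) - g).
    by rewrite -{1}(poly_take_drop r f) -/c /h; ring.
  by rewrite -exprD subnK// pcE exprD; ring.
rewrite fE; apply: le_trans (semiD hq _ _) _.
apply: (@le_trans _ _ (e + 0)); last by rewrite addr0.
apply: lerD; last first.
  apply: le_trans (semiD hq _ _) _; rewrite return_m add0r.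
  rewrite -(coefK w) poly_def mulr_sumr; apply: le_trans (semi_sum hq _ _ _) _.
  apply: sumr_le0 => i _; rewrite -scalerAr (semiZ hq) -exprD quiet_m ?mulr0//.
  exact: leq_trans (ltn_ord i) sw.
have hB : forall i, modulus h`_i <= (H + t)%:R * (B1 * d').
  apply: modulus_coefM => //.
    by apply: leq_add => //; rewrite (leq_trans (size_take_poly _ _))// ltnW.
  move=> i; rewrite coef_take_poly; case: ifP => [/small|_]; last by rewrite modulus0 ltW.
  by rewrite lt_min => /andP[_ /ltW].
have sh : (size ('X^(m - r) * h)%R <= m + H + t)%N.
  apply: leq_trans (size_polyMleq _ _) _; rewrite size_polyXn.
  have := size_polyMleq p (take_poly r f); rewrite -/h.
  have := size_take_poly r f.
  by move: sp rt rm; lia.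
apply: le_trans (semi_poly hq sh) _.
apply: (@le_trans _ _ (\sum_(i < m + H + t) (H + t)%:R * (B1 * d') * q 'X^i)).
  apply: ler_sum => i _; rewrite ler_wpM2r ?(semi_ge0 hq)// coefXnM.
  case: ifP => _; [rewrite modulus0|exact: hB].
  by apply: mulr_ge0 => //; apply: mulr_ge0 => //; exact: ltW.
rewrite -mulr_sumr -/A.
have -> : (H + t)%:R * (B1 * d') * A = C * d' by rewrite /C; ring.
by rewrite /d' mulrA ler_pdivrMr ?mulrDr; nra.
Qed.

End Pursuit.

(** * Triangular bases of polynomials *)

Section LinearCombination.
Context (R : realType) (k : scalar_kind) (V : lmodType (scalars R k)).
Local Notation K := (scalars R k).
Implicit Types (f g : {poly K}) (v : nat -> V).

Definition lcomb v f : V := \sum_(i < size f) f`_i *: v i.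

Lemma lcombE v n f : (size f <= n)%N -> lcomb v f = \sum_(i < n) f`_i *: v i.
Proof.
move=> fn; rewrite /lcomb (big_ord_widen n (fun i => f`_i *: v i) fn) big_mkcond /=.
apply: eq_bigr => i _; case: ltnP => // h; by rewrite nth_default// scale0r.
Qed.

Lemma lcombD v f g : lcomb v (f + g) = lcomb v f + lcomb v g.
Proof.
have h := size_polyD f g; rewrite (lcombE _ h).
rewrite (lcombE _ (leq_maxl (size f) (size g))) (lcombE _ (leq_maxr (size f) (size g))).
by rewrite -big_split; apply: eq_bigr => i _; rewrite coefD scalerDl.
Qed.

Lemma lcombZ v a f : lcomb v (a *: f) = a *: lcomb v f.
Proof.
rewrite (lcombE _ (size_scale_leq a f)) /lcomb scaler_sumr.
by apply: eq_bigr => i _; rewrite coefZ scalerA.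
Qed.

Lemma lcombB v f g : lcomb v (f - g) = lcomb v f - lcomb v g.
Proof. by rewrite lcombD -(scaleN1r g) lcombZ scaleN1r. Qed.

Lemma lcomb_sum v I (r : seq I) (P : pred I) (F : I -> {poly K}) :
  lcomb v (\sum_(i <- r | P i) F i) = \sum_(i <- r | P i) lcomb v (F i).
Proof.
elim/big_rec2: _ => [|i x y _ <-]; last by rewrite lcombD.
by rewrite /lcomb size_poly0 big_ord0.
Qed.

Lemma lcomb_semi v (q : V -> R) : seminorm q -> seminorm (fun f => q (lcomb v f)).
Proof. by move=> hq; split=> *; rewrite ?lcombD ?lcombZ; [exact: semiD|exact: semiZ]. Qed.

End LinearCombination.

Section TriangularBasis.
Context (R : realType) (k : scalar_kind).
Local Notation K := (scalars R k).
Implicit Types (f g P : {poly K}) (b : nat -> K).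

Variable u : nat -> {poly K}.
Hypothesis monic_u : forall n, (size (u n - 'X^n)%R <= n)%N.

Lemma size_basis n : (size (u n) <= n.+1)%N.
Proof.
rewrite -(subrK 'X^n (u n)); apply: leq_trans (size_polyD _ _) _.
by rewrite geq_max size_polyXn leqnn andbT leqW.
Qed.

Lemma coef_basis n i : (n <= i)%N -> (u n)`_i = (i == n)%:R.
Proof.
move=> ni; rewrite -(subrK 'X^n (u n)) coefD coefXn nth_default ?add0r//.
exact: leq_trans (monic_u n) ni.
Qed.

Lemma basis_expand n f : (size f <= n)%N -> exists b, f = \sum_(i < n) b i *: u i.
Proof.
elim: n f => [|n IH] f fn.
  by exists (fun=> 0); move: fn; rewrite leqn0 size_poly_eq0 => /eqP->; rewrite big_ord0.
have [|b fE] := IH (f - f`_n *: u n).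
  apply/leq_sizeP => j; rewrite coefB coefZ => nj.
  rewrite coef_basis//; case: eqP => [->|/eqP jn]; first by rewrite mulr1 subrr.
  by rewrite mulr0 subr0 nth_default// (leq_trans fn)// ltn_neqAle eq_sym jn.
exists (fun i => if (i < n)%N then b i else f`_n).
rewrite big_ord_recr /= ltnn -[LHS](subrK (f`_n *: u n)) fE; congr (_ + _).
by apply: eq_bigr => i _; rewrite ltn_ord.
Qed.

Section TriangularSolution.
Variables (V : lmodType K) (U : nat -> V).

(** Solving [lcomb v (u n) = U n] for [v], one index after the other. *)
Fixpoint basis_images n : seq V :=
  if n is n'.+1 then
    let s := basis_images n' in
    rcons s (U n' - \sum_(i < n') (u n' - 'X^n')`_i *: s`_i)
  else [::].

Definition basis_image n : V := (basis_images n.+1)`_n.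

Lemma size_basis_images n : size (basis_images n) = n.
Proof. by elim: n => //= n IH; rewrite size_rcons IH. Qed.

Lemma basis_imagesE n i : (i < n)%N -> (basis_images n)`_i = basis_image i.
Proof.
elim: n => // n IH; rewrite ltnS leq_eqVlt => /orP[/eqP->//|ltin].
by rewrite /= nth_rcons size_basis_images ltin IH.
Qed.

Lemma lcomb_basis n : lcomb basis_image (u n) = U n.
Proof.
rewrite -(subrK 'X^n (u n)) lcombD (lcombE _ (monic_u n)).
rewrite (@lcombE _ _ _ _ n.+1 'X^n) ?size_polyXn//.
rewrite big_ord_recr /= [X in _ + (X + _)]big1 ?add0r => [|i _]; last first.
  by rewrite coefXn (ltn_eqF (ltn_ord i)) scale0r.
rewrite coefXn eqxx scale1r {2}/basis_image /= nth_rcons size_basis_images ltnn eqxx.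
by under [X in _ + (_ - X)]eq_bigr do rewrite basis_imagesE//; rewrite addrC subrK.
Qed.

End TriangularSolution.

(** Back substitution from the top: the coordinate on [u t] is the coefficient of
index [t], and removing it increases the others by a bounded factor. *)
Lemma basis_bound t : exists2 d : R, 0 < d & forall b (M : R),
  (forall i, modulus (\sum_(n < t) b n *: u n)`_i <= M) ->
  forall n, (n < t)%N -> d * modulus (b n) <= M.
Proof.
elim: t => [|t [d d0 IH]]; first by exists 1.
pose W := \sum_(i < t.+1) modulus (u t)`_i.
have W0 : 0 <= W by apply: sumr_ge0 => i _; exact: modulus_ge0.
have WE i : modulus (u t)`_i <= W.
  have [it|it] := ltnP i t.+1; last first.
    by rewrite nth_default ?modulus0// (leq_trans (size_basis t)).
  rewrite /W (bigD1 (Ordinal it))//= lerDl.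
  by apply: sumr_ge0 => j _; exact: modulus_ge0.
exists (Num.min 1 (d / (1 + W))).
  by rewrite lt_min ltr01 divr_gt0//; lra.
move=> b M hM n.
have M0 : 0 <= M by apply: le_trans (hM 0%N); exact: modulus_ge0.
pose f' := \sum_(n < t) b n *: u n.
have sf' : (size f' <= t)%N.
  apply: leq_trans (size_sum _ _ _) _; apply/bigmax_leqP => i _.
  apply: leq_trans (size_scale_leq _ _) _; apply: leq_trans (size_basis _) _.
  exact: ltn_ord.
have bt : modulus (b t) <= M.
  have := hM t; rewrite big_ord_recr /= -/f' coefD coefZ coef_basis// eqxx mulr1.
  by rewrite nth_default// add0r.
have hf' i : modulus f'`_i <= M * (1 + W).
  have -> : f' = \sum_(n < t.+1) b n *: u n - b t *: u t.
    by rewrite big_ord_recr /= addrK.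
  rewrite coefB coefZ; apply: le_trans (modulusB _ _) _.
  by rewrite mulrDr mulr1 lerD// modulusM ler_pM// modulus_ge0.
rewrite ltnS leq_eqVlt => /orP[/eqP->|nt].
  apply: le_trans bt; rewrite -[leRHS]mul1r ler_wpM2r ?modulus_ge0// ge_min lexx//.
apply: (@le_trans _ _ (d / (1 + W) * modulus (b n))).
  by rewrite ler_wpM2r ?modulus_ge0// ge_min lexx orbT.
by rewrite mulrAC ler_pdivrMr; [exact: IH|lra].
Qed.

Section Pursuit.
Variables (q : {poly K} -> R) (hq : seminorm q).
Variables (t m H : nat) (g : {poly K}).
Hypotheses (tm : (t <= m)%N) (H0 : (0 < H)%N).
Hypothesis return_m : q ('X^m - g) = 0.
Hypothesis quiet_m : forall y, (y < t)%N -> q 'X^(m + H + y) = 0.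

(** Dividing by the largest coefficient reduces to [pursuit_cascade]; that
coefficient dominates all coordinates by [basis_bound].  The point is that [B]
is chosen before the vector: the multiplier [P] is bounded in terms of a single
nonzero coordinate, however large the others are. *)
Lemma pursuit (e : R) : 0 < e -> exists2 B, 0 <= B & forall b n, (n < t)%N -> b n != 0 ->
  exists P, [/\ (size P <= m + H)%N, forall i, modulus P`_i <= B / modulus (b n) &
    q (P * (\sum_(i < t) b i *: u i) - g) <= e].
Proof.
move=> e0; have [d d0 hd] := basis_bound t.
have [B B0 hB] := pursuit_cascade hq tm H0 return_m quiet_m e0 (leqnn t) ltr01.
exists (B / d); first by rewrite divr_ge0// ltW.
move=> b n nt bn0; set f := \sum_(i < t) _.
have sf : (size f <= t)%N.
  apply: leq_trans (size_sum _ _ _) _; apply/bigmax_leqP => i _.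
  apply: leq_trans (size_scale_leq _ _) _; apply: leq_trans (size_basis _) _.
  exact: ltn_ord.
have [j _ jmax] := @arg_maxP _ _ _ (Ordinal nt) xpredT (fun i : 'I_t => modulus f`_i) isT.
have fj i : modulus f`_i <= modulus f`_j.
  have [it|it] := ltnP i t; first exact: (jmax (Ordinal it)).
  by rewrite nth_default ?(leq_trans sf)// modulus0 modulus_ge0.
have dfj : d * modulus (b n) <= modulus f`_j by exact: hd fj n nt.
have bn : 0 < modulus (b n) by rewrite modulus_gt0.
have fj0 : 0 < modulus f`_j by apply: lt_le_trans dfj; exact: mulr_gt0.
have [|||P [sP PB Pe]] := hB ((f`_j)^-1 *: f).
- exact: leq_trans (size_scale_leq _ _) sf.
- move=> i; rewrite coefZ modulusM modulusV mulrC.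
  by rewrite ler_pdivrMr ?mul1r.
- exists j => //; rewrite coefZ mulVf ?modulus1//.
  by rewrite -modulus_gt0.
exists ((f`_j)^-1 *: P); split.
- exact: leq_trans (size_scale_leq _ _) sP.
- move=> i; rewrite coefZ modulusM modulusV mulrC -mulrA -invfM.
  by rewrite ler_pM ?invr_ge0 ?modulus_ge0// lef_pV2// posrE mulr_gt0.
- by rewrite -scalerAl scalerAr.
Qed.

End Pursuit.

End TriangularBasis.

(** * Tasks, phases and levels *)

Section Tasks.
Context (R : realType) (k : scalar_kind).
Local Notation K := (scalars R k).

Lemma injective_unbounded (h : nat -> nat) N : injective h -> exists r, (N <= h r)%N.
Proof.
move=> hinj; apply: contrapT => /forallNP hN.
have lt r : (h r < N)%N by rewrite ltnNge; apply/negP/hN.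
have /leq_card : injective (fun i : 'I_N.+1 => Ordinal (lt i)).
  by move=> i j /(congr1 val) /= /hinj /val_inj.
by rewrite !card_ord ltnn.
Qed.

(** A task is coded together with a counter, so that it comes back infinitely
often. *)
Lemma tasks_exist : exists (J : nat -> nat) (g : nat -> {poly K}),
  forall j (f : {poly K}) (e : R) N, 0 < e -> exists i,
    [/\ (N <= i)%N, J i = j, (size (g i) <= size f)%N &
      forall l, modulus (f`_l - (g i)`_l) < e].
Proof.
have [al hal] := scalars_separable R k.
pose task n : nat * seq nat * nat := odflt (0%N, [::], 0%N) (unpickle n).
exists (fun n => (task n).1.1), (fun n => Poly (map al (task n).1.2)) => j f e N e0.
have /choice[c hc] : forall l, exists n, modulus (f`_l - al n) < e.
  by move=> l; exact: hal.
pose s := mkseq c (size f).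
have [|r hr] := @injective_unbounded (fun r => pickle (j, s, r)) N.
  by move=> r r' /(pcan_inj pickleK)[].
exists (pickle (j, s, r)); rewrite /task pickleK /=; split => //.
  by apply: leq_trans (size_Poly _) _; rewrite size_map size_mkseq.
move=> l; rewrite coef_Poly; have [lf|lf] := ltnP l (size f).
  by rewrite (nth_map 0%N) ?size_mkseq// nth_mkseq.
rewrite (nth_default _ lf) nth_default ?size_map ?size_iota//.
by apply: le_lt_trans (modulusB _ _) _; rewrite modulus0 addr0.
Qed.

End Tasks.

(** A task [(J i, g i)] asks that some power of the operator be close to the
polynomial [g i] in the operator, for the [J i]-th seminorm.  It is treated in
phase [i], which consists of the indices from [start i] to [start i.+1]: up to
[return_time i] the level is 0, then come two blocks of equal length, along each
of which the level decreases from [J i] to 0, staying constant on segments of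
length [(start i).+1].  This is longer than any shift used in earlier phases, so
that such a shift lowers a late level by at most one. *)
Section Layout.
Context (R : realType) (k : scalar_kind).
Local Notation K := (scalars R k).
Variables (J : nat -> nat) (g : nat -> {poly K}).

Local Open Scope nat_scope.

Fixpoint start i : nat :=
  if i is i'.+1 then
    (start i').+1 + size (g i') + 2 * ((J i').+1 * (start i').+1)
  else 0.

Definition return_time i : nat := (start i).+1 + size (g i).
Definition block i : nat := (J i).+1 * (start i).+1.

Fixpoint phase n : nat :=
  if n is n'.+1 then
    if n == start (phase n').+1 then (phase n').+1 else phase n'
  else 0.

Definition slope (i o : nat) : nat := J i - o %/ (start i).+1.

Definition level n : nat :=
  let i := phase n in
  if n < return_time i then 0
  else if n < return_time i + block i then slope i (n - return_time i)
  else slope i (n - return_time i - block i).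

(** In the first block of phase [i], ['X^(return_time i + o)] is ['X^o * g i] plus a
fresh vector, which has level [J i] for small [o]. *)
Definition fresh n : {poly K} :=
  let i := phase n in
  if return_time i <= n < return_time i + block i then
    ('X^n - 'X^(n - return_time i) * g i)%R
  else 'X^n%R.

Lemma startS i : start i.+1 = return_time i + block i + block i.
Proof. by rewrite /= /return_time /block mul2n -addnn addnA. Qed.

Lemma start_lt i : start i < start i.+1.
Proof. by rewrite startS /return_time; lia. Qed.

Lemma start_mono i i' : i <= i' -> start i <= start i'.
Proof.
elim: i' => [|i' IH]; first by rewrite leqn0 => /eqP->.
rewrite leq_eqVlt => /orP[/eqP->//|]; rewrite ltnS => /IH h.
exact: leq_trans h (ltnW (start_lt _)).
Qed.

Lemma leq_start i : i <= start i.
Proof. by elim: i => // i IH; apply: leq_ltn_trans IH (start_lt i). Qed.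

Lemma phaseP n : start (phase n) <= n < start (phase n).+1.
Proof.
elim: n => [|n /andP[IH1 IH2]]; first exact: (start_lt 0).
have E : phase n.+1 = if n.+1 == start (phase n).+1 then (phase n).+1 else phase n by [].
rewrite E; case: eqP => [h|/eqP h]; first by rewrite h leqnn start_lt.
by rewrite leqW//= ltn_neqAle h.
Qed.

Lemma leq_phase i n : start i <= n -> i <= phase n.
Proof.
move=> h; rewrite leqNgt; apply/negP => /start_mono h'.
by have /andP[_] := phaseP n; rewrite ltnNge (leq_trans h' h).
Qed.

Lemma phase_eq i n : start i <= n < start i.+1 -> phase n = i.
Proof.
move=> /andP[h1 h2]; apply/eqP; rewrite eqn_leq leq_phase// andbT.
rewrite -ltnS ltnNge; apply/negP => /start_mono h.
by have /andP[h3 _] := phaseP n; move: h2; rewrite ltnNge (leq_trans h h3).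
Qed.

Lemma start_return i : start i < return_time i. Proof. by rewrite /return_time; lia. Qed.

Lemma block_gt i : start i < block i.
Proof. by rewrite /block mulSn; lia. Qed.

Section OnePhase.
Variables (i o : nat) (oi : o < block i).
Let sr := start_return i.

Lemma phase_star : phase (return_time i + o) = i.
Proof. by apply: phase_eq; rewrite startS; lia. Qed.

Lemma phase_window : phase (return_time i + block i + o) = i.
Proof. by apply: phase_eq; rewrite startS; lia. Qed.

Lemma level_star : level (return_time i + o) = slope i o.
Proof. by rewrite /level phase_star ltnNge leq_addr ltn_add2l oi/= addKn. Qed.

Lemma level_window : level (return_time i + block i + o) = slope i o.
Proof.
rewrite /level phase_window.
have -> : (return_time i + block i + o < return_time i) = false by lia.
have -> : (return_time i + block i + o < return_time i + block i) = false by lia.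
by rewrite -addnA !addKn.
Qed.

Lemma fresh_star :
  fresh (return_time i + o) = ('X^(return_time i + o) - 'X^o * g i)%R.
Proof. by rewrite /fresh phase_star leq_addr ltn_add2l oi /= addKn. Qed.

Lemma fresh_window :
  fresh (return_time i + block i + o) = 'X^(return_time i + block i + o)%R.
Proof.
rewrite /fresh phase_window.
have -> : (return_time i + block i + o < return_time i + block i) = false by lia.
by rewrite andbF.
Qed.

End OnePhase.

Lemma slope_small i o : o <= start i -> slope i o = J i.
Proof. by move=> h; rewrite /slope divn_small ?subn0. Qed.

Lemma monic_fresh n : size (fresh n - 'X^n)%R <= n.
Proof.
rewrite /fresh; case: ifP => [/andP[h _]|_]; last by rewrite subrr size_poly0.
rewrite addrAC subrr add0r size_polyN; apply: leq_trans (size_polyMleq _ _) _.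
rewrite size_polyXn; move: h; rewrite /return_time.
by move: (size (g _)) => s; lia.
Qed.

Lemma level_le n : level n <= J (phase n).
Proof. by rewrite /level; do 2?case: ifP => _ //; exact: leq_subr. Qed.

Lemma slope_slow i o a : a <= (start i).+1 -> slope i o <= (slope i (o + a)).+1.
Proof.
move=> h; rewrite /slope.
have : (o + a) %/ (start i).+1 <= (o %/ (start i).+1).+1.
  apply: (@leq_trans ((o + (start i).+1) %/ (start i).+1)).
    by rewrite leq_div2r// leq_add2l.
  by rewrite divnDr// divnn addn1.
lia.
Qed.

(** The final segment of a block, of level 0, is as long as the allowed shift:
a shift starting at positive level does not leave the block. *)
Lemma slope_gt0 i o a : a <= (start i).+1 -> 0 < slope i o -> o + a < block i.
Proof.
rewrite /slope subn_gt0 => h; rewrite ltn_divLR// => h'.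
by rewrite /block mulSn; move: h h'; lia.
Qed.

(** The shift by [a] of a fresh vector of positive level is again a fresh vector,
since it stays in the same block.  At level 0 nothing is claimed: there the size
of the shifted vector will be compensated by the choice of weights. *)
Lemma shift_fresh i n a : start i <= n -> a <= (start i).+1 -> 0 < level n ->
  ('X^a * fresh n)%R = fresh (n + a) /\ level n <= (level (n + a)).+1.
Proof.
move=> sn ai ln; have [/andP[h1 h2]] := phaseP n.
have {ai sn}ai : a <= (start (phase n)).+1.
  by apply: leq_trans ai _; rewrite ltnS start_mono// leq_phase.
set j := phase n in h1 h2 ai *.
have [nr|rn] := ltnP n (return_time j); first by move: ln; rewrite /level -/j nr.
have [nb|bn] := ltnP n (return_time j + block j).
  have [ o oj nE] : exists2 o, o < block j & n = return_time j + o.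
    by exists (n - return_time j); lia.
  move: ln; rewrite nE -addnA level_star// => so.
  have oa := slope_gt0 ai so.
  rewrite !fresh_star// level_star//; split; last exact: slope_slow.
  by rewrite mulrBr mulrA -!exprD addnCA [a + o]addnC.
have [ o oj nE] : exists2 o, o < block j & n = return_time j + block j + o.
  by exists (n - (return_time j + block j)); rewrite ?subnKC//; move: h2; rewrite startS; lia.
move: ln; rewrite nE -(addnA _ o a) level_window// => so.
have oa := slope_gt0 ai so.
rewrite !fresh_window// level_window//; split; last exact: slope_slow.
by rewrite -exprD addnC -addnA.
Qed.

End Layout.

(** * The Hahn-Banach theorem for a seminorm *)

Section RealScalar.
Context (R : realType) (k : scalar_kind).
Local Notation K := (scalars R k).

Definition real_scalar : R -> K :=
  match k return R -> scalars R k with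
  | RealScalars => fun t => t
  | ComplexScalars => fun t => (t +i* 0)%C
  end.

Lemma real_scalarD s t : real_scalar (s + t) = real_scalar s + real_scalar t.
Proof. by rewrite /real_scalar; case: k => //=; congr (_ +i* _)%C; rewrite addr0. Qed.

Lemma real_scalarM s t : real_scalar (s * t) = real_scalar s * real_scalar t.
Proof.
rewrite /real_scalar; case: k => //=.
by congr (_ +i* _)%C; rewrite ?mulr0 ?mul0r ?addr0 ?subr0.
Qed.

Lemma real_scalarN t : real_scalar (- t) = - real_scalar t.
Proof. by rewrite /real_scalar; case: k => //=; congr (_ +i* _)%C; rewrite oppr0. Qed.

Lemma real_scalar1 : real_scalar 1 = 1.
Proof. by rewrite /real_scalar; case: k. Qed.

Lemma real_scalar0 : real_scalar 0 = 0.
Proof. by rewrite /real_scalar; case: k. Qed.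

Lemma modulus_real_scalar t : modulus (real_scalar t) = `|t|.
Proof. by rewrite /real_scalar; case: k => //=; rewrite expr0n /= addr0 sqrtr_sqr. Qed.

End RealScalar.

(** For complex scalars, [g x - i * g (i * x)] is the complex linear form with
real part [g]. *)
Lemma complexification (R : realType) (k : scalar_kind) (V : lmodType (scalars R k))
    (q : V -> R) (e : V) (g : V -> R) : seminorm q -> g e != 0 ->
  (forall x y, g (x + y) = g x + g y) ->
  (forall t x, g (real_scalar k t *: x) = t * g x) -> (forall x, `|g x| <= q x) ->
  exists f : V -> scalars R k,
    [/\ scalar f, f e != 0 & forall x, modulus (f x) <= 2 * q x].
Proof.
move=> hq ge gD gZ gabs; have gN x : g (- x) = - g x.
  by rewrite -scaleN1r -(real_scalar1 R k) -real_scalarN gZ mulN1r.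
case: k V q e g hq ge gD gZ gabs gN => /= W q e g hq ge gD gZ gabs gN.
  exists g; split => //; first by move=> a x y; rewrite gD gZ.
  by move=> x; have := gabs x; have := semi_ge0 hq x; rewrite /modulus; lra.
pose f x : R[i]%C := (g x +i* - g ('i%C *: x))%C.
exists f; split.
- move=> [a b] x y; rewrite /f.
  have E z : (a +i* b)%C *: z = (a +i* 0)%C *: z + (b +i* 0)%C *: ('i%C *: z).
    rewrite scalerA -scalerDl; congr (_ *: _).
    by congr (_ +i* _)%C; rewrite /= ?mulr0 ?mul0r ?mulr1 ?addr0 ?add0r ?subr0 ?oppr0.
  have ii z : 'i%C *: ('i%C *: z) = - z.
    rewrite scalerA -scaleN1r; congr (_ *: _).
    by congr (_ +i* _)%C; rewrite /= ?mulr0 ?mul0r ?mulr1 ?mul1r ?addr0 ?add0r ?oppr0.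
  have iC c z : 'i%C *: (c *: z) = c *: ('i%C *: z) by rewrite !scalerA mulrC.
  rewrite scalerDr iC !E !gD !gZ ii gN.
  by congr (_ +i* _)%C; rewrite /=; lra.
- by apply: contra_neq ge => [[]].
- move=> x; rewrite /modulus /f.
  have -> : (g x +i* - g ('i%C *: x))%C = (g x +i* 0)%C + (0 +i* - g ('i%C *: x))%C.
    by congr (_ +i* _)%C; rewrite ?addr0 ?add0r.
  apply: le_trans (le_normcD _ _) _ => /=.
  rewrite !expr0n /= addr0 add0r !sqrtr_sqr normrN.
  have := gabs x; have := gabs ('i%C *: x); rewrite (semiZ hq) /=.
  by rewrite expr0n expr1n /= add0r sqrtr1 mul1r; lra.
Qed.

Section HahnBanach.
Context (R : realType) (k : scalar_kind).
Local Notation K := (scalars R k).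
Local Notation real_scalar := (real_scalar k).
Variable V : lmodType K.
Implicit Types (q : V -> R) (x y : V).

(** Homogeneity for real scalars only, so that real and complex spaces are treated
alike. *)
Definition sublinear q : Prop :=
  (forall x y, q (x + y) <= q x + q y) /\
  (forall t x, 0 <= t -> q (real_scalar t *: x) = t * q x).

Lemma seminorm_sublinear q : seminorm q -> sublinear q.
Proof.
move=> hq; split=> [x y|t x t0]; first exact: semiD.
by rewrite semiZ// modulus_real_scalar ger0_norm.
Qed.

Lemma sublinear0 q : sublinear q -> q 0 = 0.
Proof. by case=> _ h; rewrite -(scale0r 0) -real_scalar0 h// mul0r. Qed.

Lemma sublinear_ge q x : sublinear q -> - q (- x) <= q x.
Proof. by move=> hq; have := hq.1 x (- x); rewrite subrr sublinear0//; lra. Qed.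

(** Subhomogeneity for [t] and for its inverse gives homogeneity. *)
Lemma sublinear_by q : q 0 = 0 -> (forall x y, q (x + y) <= q x + q y) ->
  (forall t x, 0 < t -> q (real_scalar t *: x) <= t * q x) -> sublinear q.
Proof.
move=> q0 qD qZ; split => // t x; rewrite le_eqVlt => /orP[/eqP<-|t0].
  by rewrite real_scalar0 scale0r mul0r.
apply/eqP; rewrite eq_le qZ//= -ler_pdivlMl//.
have -> : q x = q (real_scalar t^-1 *: (real_scalar t *: x)).
  by rewrite scalerA -real_scalarM mulVf ?gt_eqF// real_scalar1 scale1r.
by apply: qZ; rewrite invr_gt0.
Qed.

(** The largest sublinear functional below [q] that is linear on the line
spanned by [y]. *)
Lemma sublinear_reduce q y : sublinear q -> exists q',
  [/\ sublinear q', forall x, q' x <= q x & q' (- y) <= - q y].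
Proof.
move=> hq; have [qD qZ] := hq.
pose E x := [set v | exists2 t : R, 0 <= t & v = q (x + real_scalar t *: y) - t * q y].
have Elb x : lbound (E x) (- q (- x)).
  move=> _ [t t0 ->]; have := qD (x + real_scalar t *: y) (- x).
  by rewrite addrAC subrr add0r qZ//; lra.
have Ehas x : has_lbound (E x) by exists (- q (- x)).
have E0 x : E x !=set0 by exists (q (x + real_scalar 0 *: y) - 0 * q y); exists 0.
have Eq x t : 0 <= t -> inf (E x) <= q (x + real_scalar t *: y) - t * q y.
  by move=> t0; apply: ge_inf => //; exists t.
have Eqx x : inf (E x) <= q x.
  by have := Eq x 0 (lexx _); rewrite real_scalar0 scale0r addr0 mul0r subr0.
exists (fun x => inf (E x)); split => //; last first.
  have := Eq (- y) 1 ler01; rewrite real_scalar1 scale1r addNr sublinear0// mul1r; lra.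
apply: sublinear_by.
- apply/eqP; rewrite eq_le -[leRHS](sublinear0 hq) Eqx/=.
  apply: lb_le_inf => // v /Elb; rewrite oppr0 sublinear0// oppr0//.
- move=> x z; rewrite -lerBlDr; apply: lb_le_inf => // _ [s s0 ->].
  rewrite lerBlDr -lerBlDl; apply: lb_le_inf => // _ [t t0 ->].
  have := Eq (x + z) (s + t) (addr_ge0 s0 t0).
  rewrite real_scalarD scalerDl addrACA.
  have := qD (x + real_scalar s *: y) (z + real_scalar t *: y); lra.
- move=> t x t0; rewrite -ler_pdivrMl//; apply: lb_le_inf => // _ [s s0 ->].
  rewrite ler_pdivrMl//.
  have := Eq (real_scalar t *: x) (t * s) (mulr_ge0 (ltW t0) s0).
  by rewrite real_scalarM -scalerA -scalerDr qZ ?(ltW t0)// mulrBr mulrA.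
Qed.

(** A minimal sublinear functional is linear, by [sublinear_reduce]. *)
Lemma sublinear_minorant p : sublinear p -> exists g : V -> R,
  [/\ forall x, g x <= p x, forall x y, g (x + y) = g x + g y &
    forall t x, g (real_scalar t *: x) = t * g x].
Proof.
move=> hp; pose T := {q : V -> R | sublinear q /\ forall x, q x <= p x}.
pose r (s t : T) := `[< forall x, sval t x <= sval s x >].
have [||||g gmin] := @Zorn T r.
- by move=> t; apply/asboolP.
- by move=> s t u /asboolP h1 /asboolP h2; apply/asboolP => x; exact: le_trans (h2 x) (h1 x).
- move=> [s hs] [t ht] /asboolP /= h1 /asboolP /= h2; apply: eq_exist.
  by apply/funext => x; apply/eqP; rewrite eq_le h1 h2.
- move=> A Atot; have [A0|/existsNP[s0 /contrapT As0]] := pselect (forall s, ~ A s).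
    by exists (exist _ p (conj hp (fun x => lexx _))) => s /A0.
  pose E x := [set sval s x | s in A].
  have Elb x : lbound (E x) (- p (- x)).
    move=> _ [[s [hs sp]] _ <-] /=; apply: le_trans (sublinear_ge x hs).
    by rewrite lerN2.
  have Ehas x : has_lbound (E x) by exists (- p (- x)).
  have E0 x : E x !=set0 by exists (sval s0 x); exists s0.
  have Eq x s : A s -> inf (E x) <= sval s x by move=> As; apply: ge_inf => //; exists s.
  have qp x : inf (E x) <= p x.
    by apply: le_trans (Eq x s0 As0) _; case: (s0) => s [].
  have hq : sublinear (fun x => inf (E x)).
    apply: sublinear_by.
    - apply/eqP; rewrite eq_le -[leRHS](sublinear0 hp) qp/=.
      by apply: lb_le_inf => // v /Elb; rewrite oppr0 sublinear0// oppr0.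
    - move=> x z; rewrite -lerBlDr; apply: lb_le_inf => // _ [s As <-].
      rewrite lerBlDr -lerBlDl; apply: lb_le_inf => // _ [t At <-].
      have [[sD _] _] := svalP s; have [[tD _] _] := svalP t.
      have [/asboolP st|/asboolP ts] := Atot s t As At.
        have := Eq (x + z) t At; have := tD x z; have := st x; lra.
      have := Eq (x + z) s As; have := sD x z; have := ts z; lra.
    - move=> t x t0; rewrite -ler_pdivrMl//; apply: lb_le_inf => // _ [s As <-].
      rewrite ler_pdivrMl//; have [[_ sZ] _] := svalP s.
      by rewrite -sZ ?(ltW t0)//; exact: Eq.
  exists (exist _ (fun x => inf (E x)) (conj hq qp)) => s As; apply/asboolP => x; exact: Eq.
have [hg gp] := svalP g; have [gD gZ] := hg.
have gN y : sval g (- y) = - sval g y.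
  have [q' [hq' q'g q'y]] := sublinear_reduce y hg.
  have q'p x : q' x <= p x by apply: le_trans (q'g x) (gp x).
  have := gmin (exist _ q' (conj hq' q'p)) (asboolT q'g).
  move=> /(congr1 sval) /= q'E; rewrite q'E in q'y.
  by apply/eqP; rewrite eq_le q'y/=; have := sublinear_ge y hg; lra.
exists (sval g); split => // [x y|t x].
  apply/eqP; rewrite eq_le gD/=.
  have := gD (- x) (- y); rewrite -opprD !gN; lra.
have [t0|t0] := leP 0 t; first exact: gZ.
have := gZ (- t) x; rewrite oppr_ge0 (ltW t0) => /(_ isT).
by rewrite real_scalarN scaleNr gN mulNr => /oppr_inj.
Qed.

Lemma scalar_bundle (f : V -> K) : scalar f -> exists F : {scalar V}, F =1 f.
Proof.
move=> hf.
pose M := GRing.isLinear.Build K V K _ f hf.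
pose F : {scalar V} := HB.pack f M.
by exists F.
Qed.

(** Starting from [sublinear_reduce] at [e] makes the linear minorant equal to
[q e] at [e]. *)
Lemma hahn_banach (q : V -> R) (e : V) : seminorm q -> q e != 0 ->
  exists2 f : {scalar V}, f e != 0 & forall x, modulus (f x) <= 2 * q x.
Proof.
move=> hq qe.
have [q' [hq' q'q q'e]] := sublinear_reduce e (seminorm_sublinear hq).
have [g [gq' gD gZ]] := sublinear_minorant hq'.
have gq x : g x <= q x by apply: le_trans (gq' x) (q'q x).
have gN x : g (- x) = - g x.
  by rewrite -scaleN1r -real_scalar1 -real_scalarN gZ mulN1r.
have gabs x : `|g x| <= q x.
  by rewrite ler_norml gq andbT lerNl -gN -(semiN hq) gq.
have ge : g e != 0.
  have := gq' (- e); rewrite gN => h; have : 0 < q e by rewrite lt_def qe semi_ge0.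
  by move=> h'; apply/eqP; lra.
suff [f [hf fe fq]] : exists f : V -> K,
    [/\ scalar f, f e != 0 & forall x, modulus (f x) <= 2 * q x].
  by have [F FE] := scalar_bundle hf; exists F => [|x]; rewrite FE.
exact: (complexification hq ge gD gZ gabs).
Qed.

End HahnBanach.

(** * Biorthogonal systems *)

(** Dependent choice where the condition on a term may involve all previous ones;
the sequence is obtained from the lists of its first terms. *)
Lemma sequence_by_steps (T : Type) (x0 : T) (Q : nat -> (nat -> T) -> T -> Prop) :
  (forall n s s' t, (forall i, (i < n)%N -> s i = s' i) -> Q n s t -> Q n s' t) ->
  (forall n s, (forall i, (i < n)%N -> Q i s (s i)) -> exists t, Q n s t) ->
  exists s, forall n, Q n s (s n).
Proof.
move=> Qext Qex.
have /choice[F hF] : forall ns : nat * (nat -> T), exists t,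
    (exists t', Q ns.1 ns.2 t') -> Q ns.1 ns.2 t.
  move=> ns; have [[t ht]|h] := pselect (exists t', Q ns.1 ns.2 t').
    by exists t.
  by exists x0 => /h.
pose l := fix l n := if n is n'.+1 then rcons (l n') (F (n', nth x0 (l n'))) else [::].
pose s n := nth x0 (l n.+1) n.
have sl n : size (l n) = n by elim: n => //= n IH; rewrite size_rcons IH.
have lE n i : (i < n)%N -> nth x0 (l n) i = s i.
  elim: n => // n IH; rewrite ltnS leq_eqVlt => /orP[/eqP->//|h].
  by rewrite /= nth_rcons sl h IH.
exists s => n; elim/ltn_ind: n => n IH.
have sn : s n = F (n, nth x0 (l n)) by rewrite /s /= nth_rcons sl ltnn eqxx.
rewrite sn; apply: (Qext _ (nth x0 (l n))) => [i /lE->//|].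
apply: (hF (n, nth x0 (l n))); apply: Qex => i im.
rewrite /= lE//; apply: (Qext _ s) (IH i im) => i' i'i.
by rewrite lE// (ltn_trans i'i).
Qed.

Section Biorthogonal.
Context (R : realType) (k : scalar_kind) (V : lmodType (scalars R k)).
Local Notation K := (scalars R k).
Variable p : nat -> V -> R.
Hypothesis hp : forall j, seminorm (p j).
Hypothesis p_mono : forall i j x, (i <= j)%N -> p i x <= p j x.
Hypothesis hker : forall j,
  infinite_codim [set x | p j.+1 x = 0] [set x | p j x = 0].

Lemma p_eq0 i j x : (i <= j)%N -> p j x = 0 -> p i x = 0.
Proof.
by move=> ij pj; apply/eqP; rewrite eq_le (semi_ge0 (hp i)) andbT -pj p_mono.
Qed.

(** Given finitely many earlier vectors and forms of any levels, subtracting the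
components along the earlier vectors of level at least [j] from a vector of
[ker (p j)] gives a vector annihilated by all earlier forms: those of smaller
level vanish on [ker (p j)] anyway. *)
Lemma biorthogonal_step (lev : nat -> nat) (n : nat) (s : nat -> V * {scalar V}) (j : nat) :
  (forall i, (i < n)%N -> p (lev i) (s i).1 = 0) ->
  (forall i x, (i < n)%N -> modulus ((s i).2 x) <= p (lev i).+1 x) ->
  (forall i i', (i < n)%N -> (i' < n)%N -> (s i).2 (s i').1 = (i == i')%:R) ->
  exists t : V * {scalar V}, [/\ p j t.1 = 0, forall x, modulus (t.2 x) <= p j.+1 x,
     t.2 t.1 = 1, forall i, (i < n)%N -> (s i).2 t.1 = 0 &
     forall i, (i < n)%N -> t.2 (s i).1 = 0].
Proof.
move=> s_ker s_bound s_bi.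
pose v (i : 'I_n) := if (j <= lev i)%N then (s i).1 else 0.
have v_ker i : p j (v i) = 0.
  rewrite /v; case: ifP => h; last by rewrite semi0.
  exact: p_eq0 h (s_ker i (ltn_ord i)).
have [u [pu hu]] : exists u, p j u = 0 /\
    forall a : 'I_n -> K, p j.+1 (u - \sum_i a i *: v i) <> 0.
  apply: contrapT => /forallNP h; apply: (hker (j := j)); exists n, v; split=> // u pu.
  by have /not_andP[//|/existsNP[a /contrapT ha]] := h u; exists a.
(* [p j.+1 e] is nonzero: this is [hu] for the coordinates of [u]. *)
pose e := u - \sum_(i < n) (s i).2 u *: v i.
have e_ker : p j e = 0.
  apply/eqP; rewrite eq_le (semi_ge0 (hp j)) andbT.
  apply: le_trans (semiB (hp j) _ _) _; rewrite pu add0r.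
  apply: le_trans (semi_sum (hp j) _ _ _) _; apply: sumr_le0 => i _.
  by rewrite (semiZ (hp j)) v_ker mulr0.
have e_ann i : (i < n)%N -> (s i).2 e = 0.
  move=> lin; rewrite linearB linear_sum /=.
  have [jl|lj] := leqP j (lev i).
    rewrite (bigD1 (Ordinal lin))//= linearZ /= /v /= jl s_bi// eqxx mulr1.
    rewrite big1 ?addr0 ?subrr// => l /eqP li; rewrite linearZ /=.
    case: ifP => _; last by rewrite linear0 mulr0.
    rewrite s_bi//; case: eqP => [il|]; last by rewrite mulr0.
    by case: li; apply: val_inj.
  have zero x : p j x = 0 -> (s i).2 x = 0.
    move=> px; apply/eqP; rewrite -modulus_eq0 eq_le modulus_ge0 andbT.
    by apply: le_trans (s_bound i x lin) _; rewrite (p_eq0 lj px).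
  rewrite zero// big1 ?subrr// => l _; rewrite linearZ /= zero ?mulr0//.
have [f fe fb] := @hahn_banach _ _ _ (p j.+1) e (hp _) (introN eqP (hu _)).
(* The form [f] is corrected so as to vanish on the earlier vectors.  Only those of
   level at most [j] need a correction, hence the bound by [p j.+1] survives. *)
pose C := 2 + \sum_(i < n) modulus (f (s i).1).
have C0 : 0 < C by rewrite ltr_wpDr// sumr_ge0// => i _; exact: modulus_ge0.
pose N := Num.bound C.
have CN : C < N%:R by apply: archi_boundP; exact: ltW.
have N0 : (N%:R : K) != 0 by rewrite -modulus_gt0 modulus_nat (lt_trans C0).
pose h x : K := (N%:R)^-1 * (f x - \sum_(i < n) f (s i).1 * (s i).2 x).
have [phi phiE] : exists F : {scalar V}, F =1 h.
  apply: scalar_bundle => a x y; rewrite /h linearP.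
  under eq_bigr do rewrite linearP mulrDr.
  rewrite big_split /=.
  have -> : \sum_(i < n) f (s i).1 * (a * (s i).2 x) =
      a * \sum_(i < n) f (s i).1 * (s i).2 x.
    by rewrite mulr_sumr; apply: eq_bigr => i _; rewrite mulrCA.
  by ring.
pose e' := (N%:R / f e) *: e.
exists (e', phi) => /=; split.
- by rewrite (semiZ (hp j)) e_ker mulr0.
- move=> x; rewrite phiE /h modulusM modulusV modulus_nat.
  rewrite ler_pdivrMl ?(lt_trans C0)//.
  apply: (@le_trans _ _ (C * p j.+1 x)); last by rewrite ler_wpM2r ?(semi_ge0 (hp _))// ltW.
  apply: le_trans (modulusB _ _) _; rewrite mulrDl lerD//.
  apply: le_trans (modulus_sum _ _ _) _; rewrite mulr_suml; apply: ler_sum => i _.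
  rewrite modulusM; have [ij|ji] := leqP (lev i) j.
    rewrite ler_wpM2l ?modulus_ge0//; apply: le_trans (s_bound i x (ltn_ord i)) _.
    exact: p_mono.
  suff -> : modulus (f (s i).1) = 0 by rewrite !mul0r.
  apply/eqP; rewrite eq_le modulus_ge0 andbT; apply: le_trans (fb _) _.
  by rewrite (p_eq0 ji (s_ker i (ltn_ord i))) mulr0.
- rewrite phiE /h /e' !linearZ /= big1 => [|i _]; last first.
    by rewrite linearZ /= e_ann// !mulr0.
  by rewrite subr0 mulrA mulrA mulVf// mul1r mulVf.
- by move=> i lin; rewrite linearZ /= e_ann// mulr0.
- move=> i lin; rewrite phiE /h (bigD1 (Ordinal lin))//= s_bi// eqxx mulr1.
  rewrite big1 ?addr0 ?subrr ?mulr0// => l /eqP li; rewrite s_bi//.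
  by case: eqP => [il|]; rewrite ?mulr0//; case: li; apply: val_inj.
Qed.

(** The pairs of a level and an index are treated in the order of their codes, by
[biorthogonal_step]. *)
Lemma biorthogonal_system : exists (e : nat -> nat -> V) (phi : nat -> nat -> {scalar V}),
  [/\ forall j n, p j (e j n) = 0,
      forall j n x, modulus (phi j n x) <= p j.+1 x &
      forall j n j' n', phi j n (e j' n') = ((j == j') && (n == n'))%:R].
Proof.
pose lev n := (odflt (0%N, 0%N) (unpickle n : option (nat * nat))).1.
pose Q n (s : nat -> V * {scalar V}) (t : V * {scalar V}) := [/\ p (lev n) t.1 = 0,
  forall x, modulus (t.2 x) <= p (lev n).+1 x, t.2 t.1 = 1,
  forall i, (i < n)%N -> (s i).2 t.1 = 0 & forall i, (i < n)%N -> t.2 (s i).1 = 0].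
have bi s : forall n, (forall i, (i < n)%N -> Q i s (s i)) ->
    forall i i', (i < n)%N -> (i' < n)%N -> (s i).2 (s i').1 = (i == i')%:R.
  move=> n Qs i i' lin lin'; have [ii'|ii'|->] := ltngtP i i'.
  - by have [_ _ _ -> ] := Qs i' lin'.
  - by have [_ _ _ _ ->] := Qs i lin.
  - by have [_ _ ->] := Qs i' lin'.
have [phi0 _] : exists F : {scalar V}, F =1 fun=> 0.
  by apply: scalar_bundle => a x y; rewrite mulr0 addr0.
have [||s hs] := @sequence_by_steps (V * {scalar V})%type (0, phi0) Q.
- move=> n s s' t ss' [h1 h2 h3 h4 h5]; split=> // i lin; rewrite -ss'//.
    exact: h4.
  exact: h5.
- move=> n s Qs; apply: (@biorthogonal_step lev).
  + by move=> i /Qs[].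
  + by move=> i x /Qs[].
  + exact: bi.
exists (fun j n => (s (pickle (j, n))).1), (fun j n => (s (pickle (j, n))).2).
have levE (j n : nat) : lev (pickle (j, n)) = j by rewrite /lev pickleK.
split.
- by move=> j n; have [] := hs (pickle (j, n)); rewrite levE.
- by move=> j n x; have [_] := hs (pickle (j, n)); rewrite levE.
- move=> j n j' n'; pose M := (maxn (pickle (j, n)) (pickle (j', n'))).+1.
  rewrite (bi s M) ?ltnS ?leq_maxl ?leq_maxr//.
  by congr (nat_of_bool _)%:R; rewrite (inj_eq (pcan_inj pickleK)) xpair_eqE.
Qed.

End Biorthogonal.

(** * Weights and realization of polynomials *)

Section Rows.
Context (R : realType) (k : scalar_kind).
Local Notation K := (scalars R k).
Variables (J : nat -> nat) (g : nat -> {poly K}).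
Local Notation start := (start J g).
Local Notation return_time := (return_time J g).
Local Notation block := (block J g).
Local Notation level := (level J g).
Local Notation fresh := (fresh J g).

(** The [j]-th row of weights: [lam n] has to dominate the [j]-th seminorm [q] of
finitely many vectors attached to the index [n].  Once the coordinate form of
index [n], multiplied by [lam n], is bounded by the next seminorm, these vectors
contribute little.  The factor [2 ^ n.+1] makes the contributions summable.  The
vectors are those of [row_vec] (totality of the forms), of [row_shift]
(continuity of the operator) and of [row_pursuit] (multipliers of the tasks of
the phases before [n]). *)
Record good_row (q : {poly K} -> R) (j : nat) (lam : nat -> nat) : Prop := {
  row_gt0 : forall n, (level n <= j)%N -> (0 < lam n)%N ;
  row_vec : forall n, (level n <= j)%N -> q (fresh n) *+ 2 ^ n.+1 <= (lam n)%:R ;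
  row_shift : forall n, (level n <= j)%N -> q ('X * fresh n) *+ 2 ^ n.+1 <= (lam n)%:R ;
  row_pursuit : forall i, J i = j -> exists B : R, [/\ 0 <= B,
    forall l, 1 + modulus (g i)`_l <= B,
    forall (b : nat -> K) n, (n < start i)%N -> b n != 0 -> exists P : {poly K},
      [/\ (size P <= start i.+1)%N, forall l, modulus P`_l <= B / modulus (b n) &
         q (P * (\sum_(l < start i) b l *: fresh l) - g i) <= i.+1%:R^-1] &
    forall n, (start i <= n)%N -> (level n <= j)%N ->
      (B * \sum_(a < (start i.+1).+1) q ('X^a * fresh n)) *+ 2 ^ n.+1 <= (lam n)%:R] }.

(** Finitely many conditions at each [n], since only phases [i <= n] start before
[n]; the constants [B] come from [pursuit]. *)
Lemma good_row_exists q j : seminorm q ->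
  (forall n, (j <= level n)%N -> q (fresh n) = 0) -> exists lam, good_row q j lam.
Proof.
move=> hq q0.
have /choice[B hB] : forall i, exists B : R, 0 <= B /\ (J i = j ->
    (forall l, 1 + modulus (g i)`_l <= B) /\
    forall (b : nat -> K) n, (n < start i)%N -> b n != 0 -> exists P : {poly K},
      [/\ (size P <= start i.+1)%N, forall l, modulus P`_l <= B / modulus (b n) &
         q (P * (\sum_(l < start i) b l *: fresh l) - g i) <= i.+1%:R^-1]).
  move=> i; have [Jij|nJ] := pselect (J i = j); last by exists 0.
  have lt_block o : (o <= start i)%N -> (o < block i)%N.
    by move=> h; apply: leq_ltn_trans h (block_gt _ _ _).
  have ret : q ('X^(return_time i) - g i) = 0.
    have := q0 (return_time i + 0)%N.
    rewrite level_star ?fresh_star ?lt_block// slope_small// Jij expr0 mul1r addn0.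
    by apply.
  have quiet y : (y < start i)%N -> q 'X^(return_time i + block i + y) = 0.
    move=> /ltnW yi; have := q0 (return_time i + block i + y)%N.
    by rewrite level_window ?fresh_window ?lt_block// slope_small// Jij; apply.
  have [B B0 hB] := pursuit (monic_fresh J g) hq (ltnW (start_return J g i))
    (leq_ltn_trans (leq0n _) (block_gt J g i)) ret quiet
    (divr_gt0 ltr01 (ltr0Sn R i)).
  pose G := \sum_(l < size (g i)) modulus (g i)`_l.
  have G0 : 0 <= G by apply: sumr_ge0 => l _; exact: modulus_ge0.
  exists (B + 1 + G); split; first by rewrite !addr_ge0.
  move=> _; split.
    move=> l; apply: (@le_trans _ _ (1 + G)); last lra.
    rewrite lerD2l; have [li|li] := ltnP l (size (g i)).
      rewrite /G (bigD1 (Ordinal li))//= lerDl.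
      by apply: sumr_ge0 => *; exact: modulus_ge0.
    by rewrite nth_default// modulus0.
  move=> b n nt bn; have [P [sP PB Pe]] := hB b n nt bn.
  exists P; split.
  - by rewrite startS (leq_trans sP)// leq_addr.
  - move=> l; apply: le_trans (PB l) _; rewrite ler_wpM2r ?invr_ge0 ?modulus_ge0//; lra.
  - by rewrite -div1r.
pose L n := 1 + q (fresh n) *+ 2 ^ n.+1 + q ('X * fresh n) *+ 2 ^ n.+1 +
  \sum_(i < n.+1) (B i * \sum_(a < (start i.+1).+1) q ('X^a * fresh n)) *+ 2 ^ n.+1.
have qM n f : 0 <= q f *+ n by rewrite mulrn_wge0 ?(semi_ge0 hq).
have BM n i : 0 <= (B i * \sum_(a < (start i.+1).+1) q ('X^a * fresh n)) *+ 2 ^ n.+1.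
  rewrite mulrn_wge0// mulr_ge0 ?(hB i).1// sumr_ge0// => a _; exact: semi_ge0.
have S0 n : 0 <= \sum_(i < n.+1)
    (B i * \sum_(a < (start i.+1).+1) q ('X^a * fresh n)) *+ 2 ^ n.+1.
  by apply: sumr_ge0 => i _; exact: BM.
have L1 n : 1 <= L n.
  by rewrite /L; have := S0 n; have := qM (2 ^ n.+1)%N (fresh n);
    have := qM (2 ^ n.+1)%N ('X * fresh n); lra.
have bL n : L n < (Num.bound (L n))%:R.
  by apply: archi_boundP; apply: le_trans (L1 n).
exists (fun n => Num.bound (L n)); split.
- by move=> n _; rewrite -(ltr_nat R); apply: lt_trans (bL n); apply: lt_le_trans (L1 n).
- move=> n _; apply: le_trans (ltW (bL n)).
  by rewrite /L; have := S0 n; have := qM (2 ^ n.+1)%N ('X * fresh n); lra.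
- move=> n _; apply: le_trans (ltW (bL n)).
  by rewrite /L; have := S0 n; have := qM (2 ^ n.+1)%N (fresh n); lra.
- move=> i Jij; have [B0 /(_ Jij)[h1 h2]] := hB i; exists (B i); split=> // n ni _.
  apply: le_trans (ltW (bL n)).
  have lin : (i < n.+1)%N by rewrite ltnS (leq_trans _ ni)// leq_start.
  apply: (@le_trans _ _ (\sum_(i < n.+1)
    (B i * \sum_(a < (start i.+1).+1) q ('X^a * fresh n)) *+ 2 ^ n.+1)).
    rewrite (bigD1 (Ordinal lin))//= lerDl.
    by apply: sumr_ge0 => l _; exact: BM.
  by rewrite /L; have := qM (2 ^ n.+1)%N (fresh n);
    have := qM (2 ^ n.+1)%N ('X * fresh n); lra.
Qed.

Section Assembly.
Variables (V : lmodType K) (p : nat -> V -> R).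
Hypothesis hp : forall j, seminorm (p j).
Hypothesis p_complete : forall w : nat -> V,
  (forall j (e : R), 0 < e -> exists N, forall m n, (N <= m)%N -> (N <= n)%N ->
     p j (w m - w n) < e) ->
  exists l, forall j (e : R), 0 < e -> exists N, forall n, (N <= n)%N -> p j (w n - l) < e.
Variables (e : nat -> nat -> V) (phi : nat -> nat -> {scalar V}).
Hypothesis p_e : forall j n, p j (e j n) = 0.
Hypothesis p_nondecreasing : forall i j x, (i <= j)%N -> p i x <= p j x.
Hypothesis phi_bound : forall j n x, modulus (phi j n x) <= p j.+1 x.
Hypothesis phi_e : forall j n j' n', phi j n (e j' n') = ((j == j') && (n == n'))%:R.

(** The linear map on polynomials sending the basis [fresh] to [U]. *)
Definition realize (U : nat -> V) (f : {poly K}) : V := lcomb (basis_image fresh U) f.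

Lemma realize_fresh U n : realize U (fresh n) = U n.
Proof. by rewrite /realize lcomb_basis//; exact: monic_fresh. Qed.

Lemma realize_eq (q : V -> R) (U W : nat -> V) f : seminorm q ->
  (forall n, q (U n - W n) = 0) -> q (realize U f) = q (realize W f).
Proof.
move=> hq UW; apply: (semi_eq hq).
have [b ->] := basis_expand (monic_fresh J g) (leqnn (size f)).
rewrite /realize !lcomb_sum -sumrB; apply/eqP.
rewrite eq_le (semi_ge0 hq) andbT; apply: le_trans (semi_sum hq _ _ _) _.
apply: sumr_le0 => i _; rewrite !lcombZ -!/(realize _ _) !realize_fresh -scalerBr.
by rewrite (semiZ hq) UW mulr0.
Qed.

(** The vector attached to the index [n] will be the sum of its layers.  Below its
level there are none, so that it lies in the kernel of the corresponding
seminorm. *)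
Definition layer (lam : nat -> nat -> nat) i n : V :=
  if (level n <= i)%N then (lam i n)%:R *: e i n else 0.

Lemma p_layer lam j i n : (j <= i)%N -> p j (layer lam i n) = 0.
Proof.
move=> ji; apply/eqP; rewrite eq_le (semi_ge0 (hp j)) andbT.
apply: le_trans (p_nondecreasing _ ji) _; rewrite /layer.
by case: ifP => _; rewrite ?(semi0 (hp i))// (semiZ (hp i)) p_e mulr0.
Qed.

(** The rows are chosen one after the other: the layers from [j] on lie in the
kernel of [p j], so that the [j]-th seminorm, which prescribes the [j]-th row, is
known as soon as the previous rows are. *)
Lemma layers_exist : exists lam, forall j,
  good_row (fun f => p j (realize (fun n => \sum_(i < j) layer lam i n) f)) j (lam j).
Proof.
have /choice[La hLa] : forall jW : nat * (nat -> V), exists la,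
    (forall n, (jW.1 <= level n)%N -> jW.2 n = 0) ->
    good_row (fun f => p jW.1 (realize jW.2 f)) jW.1 la.
  move=> [j W] /=; have [W0|] := pselect (forall n, (j <= level n)%N -> W n = 0).
    have [|n jn|la hla] := @good_row_exists (fun f => p j (realize W f)) j.
    - exact: lcomb_semi.
    - by rewrite realize_fresh W0// (semi0 (hp j)).
    by exists la.
  by exists (fun=> 0%N).
pose Ws := fix Ws j : nat -> V := if j is j'.+1 then fun n =>
  Ws j' n + (if (level n <= j')%N then (La (j', Ws j') n)%:R *: e j' n else 0) else fun=> 0.
pose lam j := La (j, Ws j).
have WE j n : \sum_(i < j) layer lam i n = Ws j n.
  by elim: j => [|j IH]; rewrite ?big_ord0// big_ord_recr /= IH.
exists lam => j.
have -> : (fun n => \sum_(i < j) layer lam i n) = Ws j by apply/funext => n; rewrite WE.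
apply: (hLa (j, Ws j)) => n /= jn; rewrite -WE big1// => i _.
by rewrite /layer leqNgt (leq_trans (ltn_ord i) jn).
Qed.

(** Since [phi j n] only sees the [j]-th layer, all the forms [phi j n] with [j] at
least the level of [n] are proportional on the span of [U]: the [n]-th
coordinate is bounded by [p j.+1] with the weight [lam j n], for all [j] at
once. *)
Theorem realization : exists (lam : nat -> nat -> nat) (U : nat -> V) (psi : nat -> {scalar V}),
  [/\ forall n m, psi n (U m) = (n == m)%:R,
      forall n, exists j, exists2 C : R, 0 <= C & forall x, modulus (psi n x) <= C * p j x,
      forall f j n, (level n <= j)%N ->
        modulus (psi n (realize U f)) * (lam j n)%:R <= p j.+1 (realize U f),
      forall j n, (j <= level n)%N -> p j (U n) = 0 &
      forall j, good_row (fun f => p j (realize U f)) j (lam j)].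
Proof.
have [lam hlam] := layers_exist.
pose W j n := \sum_(i < j) layer lam i n.
have WW i j j' n : (i <= j)%N -> (i <= j')%N -> p i (W j n - W j' n) = 0.
  have tail a b : (i <= a)%N -> p i (W (a + b)%N n - W a n) = 0.
    move=> ia; have -> : W (a + b)%N n = W a n + \sum_(l < b) layer lam (a + l) n.
      by rewrite /W big_split_ord.
    rewrite addrC addKr.
    apply/eqP; rewrite eq_le (semi_ge0 (hp i)) andbT.
    apply: le_trans (semi_sum (hp i) _ _ _) _; apply: sumr_le0 => l _.
    by rewrite p_layer//= (leq_trans ia)// leq_addr.
  wlog jj' : j j' / (j' <= j)%N => [h ij ij'|ij ij'].
    have [/h|/ltnW/h] := leqP j' j; first by apply.
    by rewrite (semiC (hp i)); apply.
  by rewrite -(subnKC jj') tail.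
have /choice[U hU] : forall n, exists l, forall j, p j (W j n - l) = 0.
  move=> n; have [j d d0|l hl] := p_complete (w := fun j => W j n).
    by exists j => a b ja jb; rewrite WW.
  exists l => j; apply/eqP; rewrite eq_le (semi_ge0 (hp j)) andbT.
  apply/ler_addgt0Pl => d d0; have [N hN] := hl j d d0.
  apply: le_trans (semi_tri (hp j) (W (maxn N j) n) _ _) _.
  by rewrite WW ?leq_maxr// add0r addr0 ltW// hN// leq_maxl.
have UW j n : p j (U n - W j n) = 0 by rewrite (semiC (hp j)) hU.
have qE j : (fun f => p j (realize U f)) = (fun f => p j (realize (W j) f)).
  by apply/funext => f; apply: realize_eq => // n; exact: UW.
have lam_gt0 j n : (level n <= j)%N -> (0 < lam j n)%N by exact: row_gt0.
(* The tail of the series [U m] after the [j]-th layer is in the kernel of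
   [p j.+1], hence of [phi j n]. *)
have phiU j n m : phi j n (U m) = if (level m <= j)%N then (lam j m)%:R * (n == m)%:R else 0.
  have -> : phi j n (U m) = phi j n (W j.+1 m).
    apply/eqP; rewrite -subr_eq0 -linearB /= -modulus_eq0 eq_le modulus_ge0 andbT.
    by rewrite -(UW j.+1 m).
  rewrite /W big_ord_recr linearD linear_sum /= big1 ?add0r => [|i _].
    by rewrite /layer; case: ifP => _; rewrite ?linear0// linearZ /= phi_e eqxx.
  rewrite /layer; case: ifP => _; rewrite ?linear0// linearZ /= phi_e.
  by rewrite gtn_eqF//= mulr0.
have lamK j n : (level n <= j)%N -> (lam j n)%:R != 0 :> K.
  by move=> h; rewrite -modulus_gt0 modulus_nat ltr0n lam_gt0.
have /choice[psi hpsi] : forall n, exists F : {scalar V},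
    forall x, F x = (lam (level n) n)%:R^-1 * phi (level n) n x.
  by move=> n; apply: scalar_bundle => a x y; rewrite linearP mulrDr mulrCA.
have psiU n m : psi n (U m) = (n == m)%:R.
  rewrite hpsi phiU; case: eqP => [->|_]; first by rewrite leqnn mulr1 mulVf// lamK.
  by case: ifP => _; rewrite !mulr0.
exists lam, U, psi; split => //.
- move=> n; exists (level n).+1, 1 => // x; rewrite mul1r hpsi modulusM modulusV modulus_nat.
  apply: le_trans (phi_bound (level n) n x); rewrite -[leRHS]mul1r ler_wpM2r ?modulus_ge0//.
  by rewrite invf_le1 ?ltr0n ?lam_gt0// ler1n lam_gt0.
- move=> f j n ln; have -> : modulus (psi n (realize U f)) * (lam j n)%:R
      = modulus (phi j n (realize U f)); last exact: phi_bound.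
  have [b ->] := basis_expand (monic_fresh J g) (leqnn (size f)).
  rewrite -(modulus_nat R k (lam j n)) -modulusM; congr modulus.
  rewrite /realize lcomb_sum !linear_sum mulr_suml; apply: eq_bigr => i _ /=.
  rewrite lcombZ -/(realize _ _) realize_fresh !linearZ /= psiU phiU.
  case: eqP => [<-|_]; last by rewrite mulr0 !mulr0 mul0r; case: ifP => _; rewrite !mulr0.
  by rewrite ln !mulr1.
- move=> j n jn; have -> : p j (U n) = p j (W j n) by apply: (semi_eq (hp j)); exact: UW.
  rewrite /W big1 ?(semi0 (hp j))// => i _.
  by rewrite /layer leqNgt (leq_trans (ltn_ord i) jn).
- by move=> j; rewrite qE.
Qed.

End Assembly.

End Rows.

(** * The shift operator and its orbits *)

Lemma six_sevenths (R : realType) (d : R) : 0 < d ->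
  d / 7 + (d / 7 + (d / 7 + d / 7 + (d / 7 + d / 7))) < d.
Proof. lra. Qed.

(** From now on a family [U] as given by [realization] is fixed. *)
Section Hypercyclic.
Context (R : realType) (k : scalar_kind).
Local Notation K := (scalars R k).
Variables (J : nat -> nat) (g : nat -> {poly K}).
Local Notation start := (start J g).
Local Notation return_time := (return_time J g).
Local Notation block := (block J g).
Local Notation level := (level J g).
Local Notation fresh := (fresh J g).

Variables (V : lmodType K) (p : nat -> V -> R).
Hypothesis hp : forall j, seminorm (p j).
Hypothesis p_nondecreasing : forall i j x, (i <= j)%N -> p i x <= p j x.
Hypothesis p_separating : forall x, (forall j, p j x = 0) -> x = 0.
Hypothesis p_complete : forall w : nat -> V,
  (forall j (e : R), 0 < e -> exists N, forall m n, (N <= m)%N -> (N <= n)%N ->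
     p j (w m - w n) < e) ->
  exists l, forall j (e : R), 0 < e -> exists N, forall n, (N <= n)%N -> p j (w n - l) < e.
Hypothesis tasks : forall j (f : {poly K}) (e : R) N, 0 < e -> exists i,
  [/\ (N <= i)%N, J i = j, (size (g i) <= size f)%N &
    forall l, modulus (f`_l - (g i)`_l) < e].

Variables (lam : nat -> nat -> nat) (U : nat -> V) (psi : nat -> {scalar V}).
Local Notation r := (realize J g U).
Hypothesis psiU : forall n m, psi n (U m) = (n == m)%:R.
Hypothesis psi_cont : forall n, exists j, exists2 C : R, 0 <= C &
  forall x, modulus (psi n x) <= C * p j x.
Hypothesis psi_lam : forall f j n, (level n <= j)%N ->
  modulus (psi n (r f)) * (lam j n)%:R <= p j.+1 (r f).
Hypothesis level_U : forall j n, (j <= level n)%N -> p j (U n) = 0.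
Hypothesis rows : forall j, good_row J g (fun f => p j (r f)) j (lam j).

Implicit Types (f h P : {poly K}).

Let q j f := p j (r f).

Let hq j : seminorm (q j). Proof. exact: lcomb_semi. Qed.

Let q_fresh j n : (j <= level n)%N -> q j (fresh n) = 0.
Proof. by move=> jn; rewrite /q realize_fresh level_U. Qed.

Let rB f h : r (f - h) = r f - r h. Proof. exact: lcombB. Qed.
Let rD f h : r (f + h) = r f + r h. Proof. exact: lcombD. Qed.
Let rZ a f : r (a *: f) = a *: r f. Proof. exact: lcombZ. Qed.

Let r_comb N (c : nat -> K) : r (\sum_(n < N) c n *: fresh n) = \sum_(n < N) c n *: U n.
Proof.
by rewrite /realize lcomb_sum; apply: eq_bigr => n _; rewrite lcombZ -(realize_fresh J g U n).
Qed.

Definition in_span_closure (x : V) : Prop :=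
  forall j (d : R), 0 < d -> exists f, p j (x - r f) < d.
Local Notation Y := in_span_closure.

Definition truncation N (x : V) : {poly K} := \sum_(n < N) psi n x *: fresh n.

Lemma truncationB N x y : truncation N (x - y) = truncation N x - truncation N y.
Proof. by rewrite -sumrB; apply: eq_bigr => n _; rewrite linearB scalerBl. Qed.

Lemma psi_realize f N : (size f <= N)%N -> f = truncation N (r f).
Proof.
move=> fN; have [b fE] := basis_expand (monic_fresh J g) fN.
rewrite {1}fE; apply: eq_bigr => n _; congr (_ *: _).
rewrite fE r_comb linear_sum /= (bigD1 n)//= big1 => [|i /eqP ni].
  by rewrite linearZ /= psiU eqxx mulr1 addr0.
rewrite linearZ /= psiU.
by case: eqP => [ni'|]; rewrite ?mulr0//; case: ni; apply: val_inj.
Qed.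

Lemma truncation_cont N j (P : {poly K}) : exists L, exists2 C : R, 0 <= C &
  forall x, q j (P * truncation N x) <= C * p L x.
Proof.
elim: N => [|N [L [C C0 hC]]].
  exists 0%N, 0 => // x; rewrite /truncation big_ord0 mulr0 (semi0 (hq j)) mul0r//.
have [j' [C' C'0 hC']] := psi_cont N.
exists (maxn L j'), (C + C' * q j (P * fresh N)).
  by rewrite addr_ge0// mulr_ge0// (semi_ge0 (hq j)).
move=> x; rewrite /truncation big_ord_recr mulrDr.
apply: le_trans (semiD (hq j) _ _) _; rewrite mulrDl lerD//.
  by apply: le_trans (hC x) _; rewrite ler_wpM2l// p_nondecreasing// leq_maxl.
rewrite -scalerAr (semiZ (hq j)) mulrAC ler_wpM2r ?(semi_ge0 (hq j))//.
by apply: le_trans (hC' x) _; rewrite ler_wpM2l// p_nondecreasing// leq_maxr.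
Qed.

(** As [x] is in the closure of the span, the last term can be made arbitrarily
small. *)
Lemma closure_le x (A B : R) (L : nat) (C : R) : Y x -> 0 <= C ->
  (forall f, A <= B + C * p L (x - r f)) -> A <= B.
Proof.
move=> Yx C0 h; apply/ler_addgt0Pl => d d0.
have [f hf] := Yx L (d / (1 + C)) (divr_gt0 d0 (ltr_pwDl ltr01 C0)).
apply: le_trans (h f) _; rewrite addrC lerD2r.
have : C * p L (x - r f) <= C * (d / (1 + C)) by rewrite ler_wpM2l// ltW.
move=> /le_trans; apply; rewrite mulrA ler_pdivrMr; nra.
Qed.

Lemma psi_lam_closure x j n : Y x -> (level n <= j)%N ->
  modulus (psi n x) * (lam j n)%:R <= p j.+1 x.
Proof.
move=> Yx ln; have [j' [C C0 hC]] := psi_cont n.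
apply: (closure_le (L := maxn j.+1 j') (C := C * (lam j n)%:R + 1) Yx).
  by rewrite addr_ge0// mulr_ge0.
move=> f; set y := x - r f.
have h1 : p j.+1 (r f) <= p j.+1 x + p (maxn j.+1 j') y.
  rewrite -{1}(subrK x (r f)) addrC; apply: le_trans (semiD (hp _) _ _) _.
  by rewrite lerD2l (semiC (hp _)) p_nondecreasing// leq_maxl.
have h2 : modulus (psi n x) <= C * p (maxn j.+1 j') y + modulus (psi n (r f)).
  rewrite -{1}(subrK (r f) x) -/y linearD; apply: le_trans (modulusD _ _) _.
  rewrite lerD2r; apply: le_trans (hC y) _.
  by rewrite ler_wpM2l// p_nondecreasing// leq_maxr.
have h3 := psi_lam f ln.
have : modulus (psi n x) * (lam j n)%:R <=
    (C * p (maxn j.+1 j') y + modulus (psi n (r f))) * (lam j n)%:R.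
  by rewrite ler_wpM2r.
lra.
Qed.

Lemma sum_half N M : \sum_(N <= n < M) (2 ^+ n.+1)^-1 <= (2 ^+ N)^-1 :> R.
Proof.
have [MN|/ltnW NM] := leqP M N.
  by rewrite big_geq// invr_ge0 exprn_ge0.
suff -> : \sum_(N <= n < M) (2 ^+ n.+1)^-1 = (2 ^+ N)^-1 - (2 ^+ M)^-1 :> R.
  by rewrite gerBl invr_ge0 exprn_ge0.
rewrite (telescope_sumr_eq (fun n => - (2 ^+ n)^-1))// => [|n _].
  by rewrite opprK addrC.
rewrite opprK exprS invfM addrC; lra.
Qed.

(** If [P] maps the basis vectors of index at least [N] to vectors that are small
compared with the corresponding coordinate forms, then only the truncation of a
vector at [N] matters. *)
Definition controlled (P : {poly K}) j N (c : R) : Prop := forall f n, (N <= n)%N ->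
  modulus (psi n (r f)) * q j (P * fresh n) <= c * p j.+1 (r f) / 2 ^+ n.+1.

(** The geometric series starts at [N], hence the gain of [2 ^+ N]. *)
Lemma controlled_tail P j N c : 0 <= c -> controlled P j N c -> forall f,
  q j (P * f - P * truncation N (r f)) <= c / 2 ^+ N * p j.+1 (r f).
Proof.
move=> c0 hP f; pose M := maxn N (size f).
have -> : P * f - P * truncation N (r f) = \sum_(N <= n < M) P * (psi n (r f) *: fresh n).
  rewrite {1}(psi_realize (leq_maxr N (size f))) -mulrBr -/M -mulr_sumr; congr (_ * _).
  rewrite /truncation -!(big_mkord xpredT (fun n => psi n (r f) *: fresh n)).
  by rewrite (big_cat_nat (leq0n N) (leq_maxl N (size f))) addrAC subrr add0r.
apply: le_trans (semi_sum (hq j) _ _ _) _.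
apply: (@le_trans _ _ (\sum_(N <= n < M) c * p j.+1 (r f) * (2 ^+ n.+1)^-1)).
  rewrite big_nat [leRHS]big_nat; apply: ler_sum => n /andP[Nn _].
  by rewrite -scalerAr (semiZ (hq j)); exact: hP.
rewrite -mulr_sumr [leRHS]mulrAC; apply: ler_wpM2l; last exact: sum_half.
by rewrite mulr_ge0// (semi_ge0 (hp _)).
Qed.

(** At an index of level above [j] the seminorm vanishes by [shift_fresh], at the
others it is dominated by the choice of [lam]. *)
Lemma shift_controlled j : controlled 'X j 0 1.
Proof.
move=> f n _; rewrite mul1r.
have [nj|jn] := leqP (level n) j; last first.
  have [] := @shift_fresh _ _ J g 0 n 1 (leq0n _) (ltn0Sn _) (leq_ltn_trans (leq0n _) jn).
  rewrite expr1 => -> h; rewrite q_fresh ?mulr0; last by move: (leq_trans jn h); rewrite ltnS.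
  by rewrite divr_ge0 ?exprn_ge0// (semi_ge0 (hp _)).
rewrite ler_pdivlMr ?exprn_gt0// -mulrA.
apply: le_trans (psi_lam f nj); rewrite ler_wpM2l ?modulus_ge0//.
have [_ _ h _] := rows j; have := h n nj; rewrite -[_ *+ 2 ^ _]mulr_natr natrX; exact.
Qed.

Lemma shift_cont j f : q j ('X * f) <= p j.+1 (r f).
Proof.
have := controlled_tail ler01 (@shift_controlled j) f.
by rewrite /truncation big_ord0 mulr0 subr0 expr0 divr1 mul1r.
Qed.

Lemma span_closure_realize f : Y (r f).
Proof. by move=> j d d0; exists f; rewrite subrr (semi0 (hp j)). Qed.

(** Extension of the multiplication by ['X] to the closure, by completeness; it
costs one seminorm. *)
Lemma shift_exists x : Y x -> exists2 z, Y z &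
  forall j f, p j (z - r ('X * f)) <= p j.+1 (x - r f).
Proof.
move=> Yx; have /choice[f hf] : forall n, exists f, p n (x - r f) < n.+1%:R^-1.
  by move=> n; apply: Yx; rewrite invr_gt0.
have small j (d : R) : 0 < d -> exists N, forall n, (N <= n)%N -> p j (x - r (f n)) < d.
  move=> d0; pose N := Num.bound d^-1.
  have dN : d^-1 < N%:R by apply: archi_boundP; rewrite invr_ge0 ltW.
  have N0 : 0 < N%:R :> R by apply: lt_trans dN; rewrite invr_gt0.
  exists (maxn j N) => n; rewrite geq_max => /andP[jn Nn].
  apply: le_lt_trans (p_nondecreasing _ jn) _; apply: lt_trans (hf n) _.
  rewrite -[ltRHS]invrK ltf_pV2 ?posrE ?invr_gt0//.
  by apply: lt_le_trans dN _; rewrite ler_nat leqW.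
have near j n h : p j (r ('X * f n) - r ('X * h)) <= p j.+1 (x - r (f n)) + p j.+1 (x - r h).
  rewrite -rB -mulrBr; apply: le_trans (shift_cont _ _) _.
  by rewrite rB (semiC (hp _) x (r (f n))); exact: semi_tri.
have [j d d0|z hz] := p_complete (w := fun n => r ('X * f n)).
  have [|N hN] := small j.+1 (d / 2); first lra.
  exists N => m n /hN hm /hN hn; apply: le_lt_trans (near _ _ _) _; lra.
exists z => [j d d0|j h].
  by have [N hN] := hz j d d0; exists ('X * f N); rewrite (semiC (hp j)) hN.
apply/ler_addgt0Pl => d d0.
have [|N1 hN1] := hz j (d / 2); first lra.
have [|N2 hN2] := small j.+1 (d / 2); first lra.
have := hN1 _ (leq_maxl N1 N2); have := hN2 _ (leq_maxr N1 N2).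
move: (maxn N1 N2) => n h2 h1.
apply: le_trans (semi_tri (hp j) (r ('X * f n)) _ _) _.
by have := near j n h; rewrite (semiC (hp j) z); lra.
Qed.

Lemma shift_operator : exists T : V -> V, forall x, Y x -> Y (T x) /\
  forall j f, p j (T x - r ('X * f)) <= p j.+1 (x - r f).
Proof.
have /choice[T hT] : forall x, exists z, Y x -> Y z /\
    forall j f, p j (z - r ('X * f)) <= p j.+1 (x - r f).
  move=> x; have [Yx|nY] := pselect (Y x); last by exists 0 => /nY.
  by have [z Yz hz] := shift_exists Yx; exists z.
by exists T.
Qed.

Section Operator.
Variable T : V -> V.
Hypothesis hT : forall x, Y x -> Y (T x) /\
  forall j f, p j (T x - r ('X * f)) <= p j.+1 (x - r f).

Lemma operator_linear a x y : Y x -> Y y -> Y (a *: x + y) ->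
  T (a *: x + y) = a *: T x + T y.
Proof.
move=> Yx Yy Yxy; apply/eqP; rewrite -subr_eq0; apply/eqP; apply: p_separating => j.
apply/eqP; rewrite eq_le (semi_ge0 (hp j)) andbT; set z := T _ - _.
apply: (closure_le (L := j.+1) (C := 2 * modulus a) Yx).
  by rewrite mulr_ge0 ?modulus_ge0.
move=> f; apply: (closure_le (L := j.+1) (C := 2) Yy) => // h.
have h1 := (hT Yxy).2 j (a *: f + h).
have h2 := (hT Yx).2 j f; have h3 := (hT Yy).2 j h.
have E1 : p j.+1 (a *: x + y - r (a *: f + h)) <=
    modulus a * p j.+1 (x - r f) + p j.+1 (y - r h).
  rewrite rD rZ opprD addrACA -scalerBr -(semiZ (hp _)); exact: semiD.
have E2 : p j (a *: T x + T y - r ('X * (a *: f + h))) <=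
    modulus a * p j (T x - r ('X * f)) + p j (T y - r ('X * h)).
  rewrite mulrDr -scalerAr rD rZ opprD addrACA -scalerBr -(semiZ (hp _)); exact: semiD.
have := semi_tri (hp j) (r ('X * (a *: f + h))) (T (a *: x + y)) (a *: T x + T y).
rewrite -/z [X in _ <= _ + X](semiC (hp j)).
have : modulus a * p j (T x - r ('X * f)) <= modulus a * p j.+1 (x - r f).
  by rewrite ler_wpM2l// modulus_ge0.
lra.
Qed.

Lemma iter_closure m x : Y x -> Y (iter m T x).
Proof. by move=> Yx; elim: m => //= m /hT[]. Qed.

Lemma iter_near m x j f : Y x ->
  p j (iter m T x - r ('X^m * f)) <= p (j + m)%N (x - r f).
Proof.
move=> Yx; elim: m j => [|m IH] j; first by rewrite expr0 mul1r addn0.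
rewrite iterS exprS -mulrA; apply: le_trans ((hT (iter_closure m Yx)).2 _ _) _.
by apply: le_trans (IH j.+1) _; rewrite addSnnS.
Qed.

(** The value at [x] of the polynomial [P] in the operator. *)
Definition poly_iter (P : {poly K}) (x : V) : V := lcomb (fun m => iter m T x) P.

Lemma poly_iterXn m x : poly_iter 'X^m x = iter m T x.
Proof.
rewrite /poly_iter (@lcombE _ _ _ _ m.+1) ?size_polyXn// big_ord_recr /= big1.
  by rewrite coefXn eqxx scale1r add0r.
by move=> i _; rewrite coefXn ltn_eqF// scale0r.
Qed.

Lemma poly_iter_near (P : {poly K}) x j f : Y x ->
  p j (poly_iter P x - r (P * f)) <=
    (\sum_(m < size P) modulus P`_m) * p (j + size P)%N (x - r f).
Proof.
move=> Yx; have -> : r (P * f) = \sum_(m < size P) P`_m *: r ('X^m * f).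
  rewrite -{1}(coefK P) poly_def mulr_suml /realize lcomb_sum.
  by apply: eq_bigr => m _; rewrite -scalerAl lcombZ.
rewrite /poly_iter /lcomb -sumrB; apply: le_trans (semi_sum (hp j) _ _ _) _.
rewrite mulr_suml; apply: ler_sum => m _.
rewrite -scalerBr (semiZ (hp j)) ler_wpM2l ?modulus_ge0//.
apply: le_trans (iter_near _ _ _ Yx) _; apply: p_nondecreasing.
by rewrite leq_add2l ltnW.
Qed.

Lemma poly_iter_tail P j N c x : 0 <= c -> controlled P j N c -> Y x ->
  p j (poly_iter P x - r (P * truncation N x)) <= c / 2 ^+ N * p j.+1 x.
Proof.
move=> c0 hP Yx; have [L [C C0 hC]] := truncation_cont N j P.
pose A := \sum_(m < size P) modulus P`_m.
have A0 : 0 <= A by apply: sumr_ge0 => m _; exact: modulus_ge0.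
have cN : 0 <= c / 2 ^+ N by rewrite divr_ge0// exprn_ge0.
pose M := maxn (j + size P) (maxn L j.+1).
apply: (closure_le (L := M) (C := A + C + c / 2 ^+ N) Yx).
  by rewrite !addr_ge0.
move=> f; have h1 := poly_iter_near P j f Yx; rewrite -/A in h1.
have h2 := controlled_tail c0 hP f; rewrite /q rB in h2.
have h3 := hC (x - r f); rewrite truncationB mulrBr /q rB in h3.
have m1 : p (j + size P)%N (x - r f) <= p M (x - r f).
  by rewrite p_nondecreasing// leq_maxl.
have m2 : p L (x - r f) <= p M (x - r f).
  by rewrite p_nondecreasing// /M maxnCA leq_maxl.
have m3 : p j.+1 (x - r f) <= p M (x - r f).
  by rewrite p_nondecreasing// /M maxnA leq_maxr.
have m4 : p j.+1 (r f) <= p j.+1 x + p j.+1 (x - r f).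
  rewrite -{1}(subrK x (r f)) addrC; apply: le_trans (semiD (hp _) _ _) _.
  by rewrite lerD2l (semiC (hp _)).
have t1 := semi_tri (hp j) (r (P * f)) (poly_iter P x) (r (P * truncation N x)).
have t2 := semi_tri (hp j) (r (P * truncation N (r f))) (r (P * f)) (r (P * truncation N x)).
rewrite (semiC (hp j) (r (P * truncation N (r f)))) in t2.
have a1 := ler_wpM2l A0 m1; have a2 := ler_wpM2l C0 m2.
have a3 := ler_wpM2l cN (le_trans m4 (lerD (lexx _) m3)).
lra.
Qed.

End Operator.

(** If all coordinates of [x] vanish, those of an approximation [f] are those of
[f - x], so that [f] is bounded for [p j] by [f - x] for [p j.+1]. *)
Lemma span_closure_psi x : Y x -> x != 0 -> exists n, psi n x != 0.
Proof.
move=> Yx x0; apply: contrapT => /forallNP h.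
have {}h n : psi n x = 0 by apply/eqP; have := h n => /negP; rewrite negbK.
case/eqP: x0; apply: p_separating => j; apply/eqP; rewrite eq_le (semi_ge0 (hp j)) andbT.
apply: (closure_le (L := j.+1) (C := 2) Yx) => // f; rewrite add0r.
pose N := size f.
have fE := psi_realize (leqnn N); rewrite -/N in fE.
have h1 : p j (r f) <= p j.+1 (x - r f).
  have rE : r f = \sum_(n < N) psi n (r f) *: U n 
    by rewrite -(r_comb N (fun n => psi n (r f))) -/(truncation N (r f)) -fE.
  rewrite {1}rE.
  apply: le_trans (semi_sum (hp j) _ _ _) _.
  apply: (@le_trans _ _ (\sum_(0 <= n < N) p j.+1 (x - r f) * (2 ^+ n.+1)^-1)).
    rewrite big_mkord; apply: ler_sum => n _.
    rewrite (semiZ (hp j)).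
    have [nj|jn] := leqP (level n) j; last first.
      by rewrite level_U ?mulr0 ?mulr_ge0 ?(semi_ge0 (hp _)) ?invr_ge0 ?exprn_ge0// ltnW.
    rewrite ler_pdivlMr ?exprn_gt0// -mulrA.
    have Yd : Y (x - r f).
      move=> i d d0; have [f' hf'] := Yx i d d0; exists (f' - f).
      by rewrite rB opprB addrA subrK.
    have -> : modulus (psi n (r f)) = modulus (psi n (x - r f)).
      by rewrite linearB h sub0r modulusN.
    apply: le_trans (psi_lam_closure Yd nj); rewrite ler_wpM2l ?modulus_ge0//.
    have [_ hv _ _] := rows j; have := hv n nj.
    by rewrite realize_fresh -[_ *+ 2 ^ _]mulr_natr natrX.
  rewrite -mulr_sumr -[leRHS]mulr1 ler_wpM2l ?(semi_ge0 (hp _))//.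
  by apply: le_trans (sum_half _ _) _; rewrite expr0 invr1.
have h2 := semiD (hp j) (x - r f) (r f); rewrite subrK in h2.
have := p_nondecreasing (x - r f) (leqnSn j); lra.
Qed.

Section Orbits.
Variable T : V -> V.
Hypothesis hT : forall x, Y x -> Y (T x) /\
  forall j f, p j (T x - r ('X * f)) <= p j.+1 (x - r f).

(** A multiplier occurring in phase [i] is controlled from [start i] on: within the
phase all levels are at most [J i], where the weights decide; afterwards, the
levels above [J i] decrease slowly enough for [shift_fresh] to apply. *)
Lemma phase_controlled i j B : J i = j -> 0 <= B ->
  (forall n, (start i <= n)%N -> (level n <= j)%N ->
      (B * \sum_(a < (start i.+1).+1) q j ('X^a * fresh n)) *+ 2 ^ n.+1 <= (lam j n)%:R) ->
  forall P c, 0 <= c -> (size P <= (start i.+1).+1)%N ->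
   (forall l, modulus P`_l <= c * B) -> controlled P j (start i) c.
Proof.
move=> Jij B0 hB P c c0 sP PB f n ni.
have qP : q j (P * fresh n) <= c * (B * \sum_(a < (start i.+1).+1) q j ('X^a * fresh n)).
  rewrite -{1}(coefK P) poly_def mulr_suml.
  apply: le_trans (semi_sum (hq j) _ _ _) _; rewrite mulrA mulr_sumr.
  rewrite (big_ord_widen _ (fun a => q j (P`_a *: 'X^a * fresh n)) sP) big_mkcond /=.
  apply: ler_sum => a _; case: ifP => _; last first.
    by rewrite !mulr_ge0// (semi_ge0 (hq j)).
  by rewrite -scalerAl (semiZ (hq j)) ler_wpM2r ?(semi_ge0 (hq j)).
have [nj|jn] := leqP (level n) j.
  apply: (@le_trans _ _ (c * (modulus (psi n (r f)) *
      (B * \sum_(a < (start i.+1).+1) q j ('X^a * fresh n))))).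
    by rewrite mulrCA ler_wpM2l// modulus_ge0.
  rewrite -mulrA ler_wpM2l// ler_pdivlMr ?exprn_gt0// -mulrA.
  apply: le_trans (psi_lam f nj); rewrite ler_wpM2l ?modulus_ge0//.
  by have := hB n ni nj; rewrite -[_ *+ 2 ^ _]mulr_natr natrX.
have ni1 : (start i.+1 <= n)%N.
  have := leq_phase ni; rewrite leq_eqVlt => /orP[/eqP ip|/(start_mono J g) h].
    by have := level_le J g n; rewrite -ip Jij leqNgt jn.
  by apply: leq_trans h _; have /andP[] := phaseP J g n.
have zero : \sum_(a < (start i.+1).+1) q j ('X^a * fresh n) = 0.
  apply: big1 => a _; have la := ltnW (ltn_ord a).
  have [-> h] := shift_fresh ni1 la (leq_ltn_trans (leq0n _) jn).
  by rewrite q_fresh//; move: (leq_trans jn h); rewrite ltnS.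
move: qP; rewrite zero !mulr0 => qP.
have -> : q j (P * fresh n) = 0 by apply/eqP; rewrite eq_le qP (semi_ge0 (hq j)).
by rewrite mulr0 divr_ge0 ?exprn_ge0// mulr_ge0// (semi_ge0 (hp _)).
Qed.

(** The multiplier ['X^(return_time i) - g i] maps ['X^l], for [l < start i], to the
fresh vector of index [return_time i + l], whose level is [J i]. *)
Lemma return_near i x : Y x ->
  p (J i) (iter (return_time i) T x - poly_iter T (g i) x) <= (2 ^+ start i)^-1 * p (J i).+1 x.
Proof.
move=> Yx; have [_ _ _ /(_ i erefl)[B [B0 gB _ hB]]] := rows (J i).
pose P : {poly K} := 'X^(return_time i) - g i.
have hP : controlled P (J i) (start i) 1.
  apply: (phase_controlled erefl B0 hB) => //.
    apply: leq_trans (size_polyD _ _) _; rewrite size_polyN size_polyXn geq_max startS.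
    by rewrite /return_time; move: (size (g i)) (block i) (start i) => a b c; lia.
  move=> l; rewrite mul1r coefB coefXn; apply: le_trans (modulusB _ _) _.
  apply: le_trans (gB l); rewrite lerD2r; case: (l == _); rewrite ?modulus1 ?modulus0//.
have := poly_iter_tail hT ler01 hP Yx; rewrite mul1r.
suff -> : p (J i) (poly_iter T P x - r (P * truncation (start i) x)) =
    p (J i) (iter (return_time i) T x - poly_iter T (g i) x) by [].
apply: (semi_eq (hp _)).
have -> : poly_iter T P x = iter (return_time i) T x - poly_iter T (g i) x.
  by rewrite /poly_iter lcombB -/(poly_iter T _ x) poly_iterXn.
rewrite addrAC subrr add0r (semiN (hp _)).
set s := truncation _ _; have ss : (size s <= start i)%N.
  apply: leq_trans (size_sum _ _ _) _; apply/bigmax_leqP => n _.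
  apply: leq_trans (size_scale_leq _ _) _.
  by apply: leq_trans (size_basis (monic_fresh J g) _) _; exact: ltn_ord.
rewrite -(coefK s) poly_def mulr_sumr; apply/eqP.
rewrite eq_le [X in _ && X](semi_ge0 (hp _)) andbT.
apply: le_trans (semi_sum (hq (J i)) _ _ _) _; apply: sumr_le0 => l _.
have lt : (l < start i)%N by exact: leq_trans (ltn_ord l) ss.
have lb : (l < block i)%N by exact: ltn_trans lt (block_gt J g i).
rewrite -scalerAr (semiZ (hq _)).
have -> : P * 'X^l = fresh (return_time i + l) by rewrite fresh_star// exprD mulrBl [g i * _]mulrC.
by rewrite q_fresh ?mulr0// level_star// slope_small// ltnW.
Qed.

(** [pursuit] applied to the truncation of [x] at [start i]. *)
Lemma pursuit_near i n x : Y x -> (n < start i)%N -> psi n x != 0 ->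
  exists P, p (J i) (poly_iter T P x - r (g i)) <=
    i.+1%:R^-1 + (modulus (psi n x))^-1 / 2 ^+ start i * p (J i).+1 x.
Proof.
move=> Yx ni xn; have [_ _ _ /(_ i erefl)[B [B0 _ hP hB]]] := rows (J i).
have [P [sP PB Pe]] := hP (fun n => psi n x) n ni xn.
exists P; rewrite [leRHS]addrC.
apply: le_trans (semi_tri (hp _) (r (P * truncation (start i) x)) _ _) _.
apply: lerD; last by rewrite -rB.
apply: poly_iter_tail => //; first by rewrite invr_ge0 modulus_ge0.
apply: (phase_controlled erefl B0 hB); first by rewrite invr_ge0 modulus_ge0.
  exact: leq_trans sP (leqnSn _).
by move=> l; rewrite mulrC.
Qed.

Lemma task_near (w : nat -> V) j P (d : R) N : 0 < d -> exists i,
  [/\ (N <= i)%N, J i = j & p j (lcomb w P - lcomb w (g i)) < d].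
Proof.
move=> d0; pose A := \sum_(l < size P) p j (w l).
have A0 : 0 <= A by apply: sumr_ge0 => l _; exact: semi_ge0.
have d'0 : 0 < d / (1 + A) by rewrite divr_gt0//; lra.
have [i [Ni Jij sg hg]] := tasks j P N d'0; exists i; split => //.
rewrite (lcombE _ sg) /lcomb -sumrB; apply: le_lt_trans (semi_sum (hp j) _ _ _) _.
apply: (@le_lt_trans _ _ (d / (1 + A) * A)).
  rewrite mulr_sumr; apply: ler_sum => l _.
  by rewrite -scalerBl (semiZ (hp j)) ler_wpM2r ?(semi_ge0 (hp j))// ltW.
by rewrite mulrAC ltr_pdivrMr; nra.
Qed.

Lemma late_small (c d : R) : 0 <= c -> 0 < d -> exists N, forall i, (N <= i)%N ->
  i.+1%:R^-1 <= d /\ c / 2 ^+ start i <= d.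
Proof.
move=> c0 d0; pose N := Num.bound ((1 + c) / d).
have h : (1 + c) / d < N%:R by apply: archi_boundP; rewrite divr_ge0 ?ltW//; lra.
have {}h : 1 + c < N%:R * d by rewrite -ltr_pdivrMr.
have big x : N%:R <= x -> 1 + c <= d * x.
  by move=> Nx; rewrite mulrC; apply: le_trans (ltW h) _; rewrite ler_wpM2r// ltW.
exists N => i Ni; split.
  rewrite -[leLHS]mul1r ler_pdivrMr//.
  have := big i.+1%:R; rewrite ler_nat leqW// => /(_ isT); lra.
rewrite ler_pdivrMr ?exprn_gt0//.
have : N%:R <= 2 ^+ start i :> R.
  rewrite -natrX ler_nat; apply: leq_trans Ni _; apply: leq_trans (leq_start J g i) _.
  by apply: ltnW; exact: ltn_expl.
by move=> /big; apply: le_trans; rewrite lerDr ler01.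
Qed.

(** [z] is close to [g i] applied to the cyclic vector for some late [i], hence to
[P] in the operator applied to [x], where [P] depends on [x] in an uncontrolled
way.  But [P] can be replaced by a polynomial [g i'] of the enumeration, which
is approximated at [x] by a power of the operator as late as desired. *)
Theorem orbit_dense x z j (d : R) : Y x -> x != 0 -> Y z -> 0 < d ->
  exists m, p j (iter m T x - z) < d.
Proof.
move=> Yx x0 Yz d0; have [n xn] := span_closure_psi Yx x0.
have d7 : 0 < d / 7 by lra.
have [f hf] := Yz j _ d7.
have c0 : 0 <= (modulus (psi n x))^-1 * p j.+1 x.
  by rewrite mulr_ge0 ?invr_ge0 ?modulus_ge0// (semi_ge0 (hp _)).
have [N hN] := late_small c0 d7.
have [i [Ni Jij hi]] := @task_near (basis_image fresh U) j f (d / 7) (maxn N n.+1) d7.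
move: Ni; rewrite geq_max => /andP[Ni ni].
have [P] := pursuit_near Yx (leq_trans ni (leq_start J g i)) xn.
have [e1 e2] := hN i Ni; rewrite Jij mulrAC => /le_trans/(_ (lerD e1 e2)) hP.
have c0' : 0 <= p j.+1 x by exact: semi_ge0.
have [N' hN'] := late_small c0' d7.
have [i' [Ni' Jij' hi']] := @task_near (fun m => iter m T x) j P (d / 7) N' d7.
have [_ e3] := hN' i' Ni'.
have hr := @return_near i' x Yx; rewrite Jij' mulrC in hr.
have {e3}hr := le_trans hr e3.
exists (return_time i').
have t1 := semi_tri (hp j) (poly_iter T (g i') x) (iter (return_time i') T x) z.
have t2 := semi_tri (hp j) (poly_iter T P x) (poly_iter T (g i') x) z.
have t3 := semi_tri (hp j) (r (g i)) (poly_iter T P x) z.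
have t4 := semi_tri (hp j) (r f) (r (g i)) z.
rewrite (semiC (hp j) (r f) z) (semiC (hp j) (r (g i)) (r f)) in t4.
rewrite (semiC (hp j) (poly_iter T (g i') x) (poly_iter T P x)) in t2.
apply: le_lt_trans t1 _; apply: le_lt_trans (lerD hr t2) _.
apply: le_lt_trans (lerD (lexx _) (lerD (ltW hi') t3)) _.
apply: le_lt_trans (lerD (lexx _) (lerD (lexx _) (lerD hP t4))) _.
apply: le_lt_trans (lerD (lexx _) (lerD (lexx _)
  (lerD (lexx _) (lerD (ltW hi) (ltW hf))))) _.
exact: six_sevenths.
Qed.

End Orbits.

End Hypercyclic.

(** * Completeness and topology *)

Section Completeness.
Context (R : realType) (k : scalar_kind) (X : topologicalLmodType (scalars R k)).
Variables (p : nat -> X -> R) (hX : is_frechet p).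

Lemma frechet_semi j : seminorm (p j).
Proof. by have [_ hD hZ] := frechet_seminorm hX j. Qed.

Lemma frechet_mono i j x : (i <= j)%N -> p i x <= p j x.
Proof.
elim: j => [|j IH]; first by rewrite leqn0 => /eqP->.
rewrite leq_eqVlt => /orP[/eqP->//|/IH h]; apply: le_trans h _.
exact: frechet_nondecreasing hX _ _.
Qed.

Let a (x y : X) j : R := 2^-1 ^+ j.+1 * Num.min 1 (p j (x - y)).

Let a_ge0 x y j : 0 <= a x y j.
Proof.
by rewrite mulr_ge0 ?exprn_ge0 ?invr_ge0// le_min ler01 (semi_ge0 (frechet_semi j)).
Qed.

Let a_half x y j : a x y j <= (2 ^+ j.+1)^-1.
Proof. by rewrite /a exprVn ler_piMr ?invr_ge0 ?exprn_ge0// ge_min lexx. Qed.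

Let a_mono x y : {homo series (a x y) : n m / (n <= m)%N >-> n <= m}.
Proof. by apply: nondecreasing_series => n _ _. Qed.

Let a_bound x y N n : series (a x y) n <= p N (x - y) + (2 ^+ N)^-1.
Proof.
have pN0 : 0 <= p N (x - y) by exact: (semi_ge0 (frechet_semi N)).
have h M : (M <= N)%N -> \sum_(0 <= j < M) a x y j <= p N (x - y).
  move=> MN; apply: (@le_trans _ _ (\sum_(0 <= j < M) p N (x - y) * (2 ^+ j.+1)^-1)).
    rewrite big_nat [leRHS]big_nat; apply: ler_sum => j /andP[_ jM].
    rewrite /a exprVn mulrC ler_wpM2r ?invr_ge0 ?exprn_ge0// ge_min frechet_mono ?orbT//.
    by rewrite (leq_trans (ltnW jM)).
  rewrite -mulr_sumr -[leRHS]mulr1 ler_wpM2l//.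
  by apply: le_trans (sum_half _ _ _) _; rewrite expr0 invr1.
rewrite /series /=; have [nN|/ltnW Nn] := leqP n N.
  by rewrite -[leLHS]addr0 lerD ?h// invr_ge0 exprn_ge0.
rewrite (big_cat_nat (leq0n N) Nn) lerD ?h//.
apply: le_trans (sum_half R N n); rewrite big_nat [leRHS]big_nat.
by apply: ler_sum => j _; exact: a_half.
Qed.

Let a_cvg x y : cvgn (series (a x y)).
Proof.
apply: nondecreasing_is_cvgn => //.
by exists (p 0%N (x - y) + (2 ^+ 0)^-1) => _ [n _ <-]; exact: a_bound.
Qed.

Lemma frechet_dist_le x y N : frechet_dist p x y <= p N (x - y) + (2 ^+ N)^-1.
Proof. by apply: (limr_le (@a_cvg x y)); apply: nearW => n; exact: a_bound. Qed.

Lemma frechet_dist_ge x y j : 2^-1 ^+ j.+1 * Num.min 1 (p j (x - y)) <= frechet_dist p x y.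
Proof.
apply: (@le_trans _ _ (series (a x y) j.+1)); last exact: (nondecreasing_cvgn_le (@a_mono x y) (@a_cvg x y)).
by rewrite /series /= big_nat_recr//= lerDr; apply: sumr_ge0.
Qed.

(** Cauchy sequences for the distance are those that are Cauchy for each
seminorm. *)
Lemma frechet_seq_complete (w : nat -> X) :
  (forall j (e : R), 0 < e -> exists N, forall m n, (N <= m)%N -> (N <= n)%N ->
     p j (w m - w n) < e) ->
  exists l, forall j (e : R), 0 < e -> exists N, forall n, (N <= n)%N -> p j (w n - l) < e.
Proof.
move=> hw; have [e e0|l hl] := frechet_is_complete hX (u := w).
  pose j := Num.bound (2 / e).
  have je : 2 / e < j%:R by apply: archi_boundP; rewrite divr_ge0 ?ltW.
  have je' : (2 ^+ j)^-1 <= e / 2.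
    rewrite -[leRHS]invrK invf_div lef_pV2 ?posrE ?exprn_gt0 ?divr_gt0//.
    by apply: le_trans (ltW je) _; rewrite -natrX ler_nat ltnW// ltn_expl.
  have [|N hN] := hw j (e / 2); first by rewrite divr_gt0.
  exists N => m n Nm Nn; apply: le_lt_trans (frechet_dist_le _ _ j) _.
  by have := hN m n Nm Nn; lra.
exists l => j e e0; pose d := 2^-1 ^+ j.+1 * Num.min 1 e.
have d0 : 0 < d by rewrite mulr_gt0 ?exprn_gt0 ?invr_gt0// lt_min ltr01.
have [N _ hN] := (cvgrPdist_lt _ _).1 hl d d0.
exists N => n Nn; have := hN n Nn; rewrite /= sub0r normrN => h.
have := le_lt_trans (le_trans (frechet_dist_ge (w n) l j) (ler_norm _)) h.
rewrite /d ltr_pM2l ?exprn_gt0 ?invr_gt0// lt_min !gt_min ltxx/=.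
by move=> /andP[h1 /orP[|//]]; exact: lt_trans.
Qed.

End Completeness.

Section Main.
Context (R : realType) (k : scalar_kind) (X : topologicalLmodType (scalars R k)).
Local Notation K := (scalars R k).
Variables (p : nat -> X -> R) (hX : is_frechet p).

Let hp := frechet_semi hX.

Lemma frechet_nbhs x j (d : R) : 0 < d -> nbhs x [set y | p j (y - x) < d].
Proof.
move=> d0; rewrite (frechet_topology hX); exists (j, d) => // y /= h.
exact: h.
Qed.

Lemma frechet_nbhsP x (A : set X) : nbhs x A ->
  exists j, exists2 d : R, 0 < d & forall y, p j (y - x) < d -> A y.
Proof.
rewrite (frechet_topology hX) => -[[j d] /= d0 h]; exists j, d => // y py.
by apply: h => i ij /=; apply: le_lt_trans py; exact: frechet_mono.
Qed.

Variable Y : submodClosed X.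
Local Notation sY := (subspace_type Y).

Lemma subspace_nbhsP (y : sY) (A : set sY) : nbhs y A ->
  exists j, exists2 d : R, 0 < d & forall z : sY, p j (val z - val y) < d -> A z.
Proof.
move=> [_ [[B oB <-] By BA]].
have [j [d d0 h]] := frechet_nbhsP (open_nbhs_nbhs (conj oB By)).
by exists j, d => // z pz; apply: BA; exact: h.
Qed.

Lemma subspace_nbhs (y : sY) j (d : R) : 0 < d ->
  nbhs y [set z : sY | p j (val z - val y) < d].
Proof.
move=> d0.
exact: (@initial_continuous sY X val y _ (frechet_nbhs (val y) j d0)).
Qed.

Lemma subspace_continuous (T : sY -> sY) : 
  (forall j x y, p j (val (T y) - val (T x)) <= p j.+1 (val y - val x)) -> continuous T.
Proof.
move=> hT x A /subspace_nbhsP[j [d d0 h]].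
apply: (filterS _ (subspace_nbhs x j.+1 d0)) => y /= hy.
by apply: h; apply: le_lt_trans (hT _ _ _) hy.
Qed.

(** A nonzero vector of a closed invariant set carries its whole dense orbit
into it. *)
Lemma dense_orbits_no_invariant_subset (T : sY -> sY) :
  (forall (x z : sY) j (d : R), x != 0 -> 0 < d ->
     exists m, p j (val (iter m T x) - val z) < d) ->
  ~ has_nontrivial_invariant_subset T.
Proof.
move=> hT [M [[x0 Mx0] clM M0 MT inv]].
have [x Mx xn0] : exists2 x, M x & x != 0.
  apply: contrapT => h; apply: M0; apply/seteqP.
  have h0 x : M x -> x = 0 by move=> Mx; apply: contrapT => /eqP ?; apply: h; exists x.
  by split=> [x /h0//|x ->]; rewrite -(h0 _ Mx0).
apply: MT; apply/seteqP; split=> // z _; apply: clM => B /subspace_nbhsP[j [d d0 h]].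
have [m hm] := hT x z j d xn0 d0; exists (iter m T x); split; last exact: h.
by elim: m {hm} => //= m IH; apply: inv; exists (iter m T x).
Qed.

(** A factorization of an identity matrix of size [n.+1] through dimension [n] is
impossible. *)
Lemma biorthogonal_infinite_dimensional (U : nat -> sY) (psi : nat -> {scalar X}) :
  (forall n m, psi n (val (U m)) = (n == m)%:R) -> infinite_dimensional sY.
Proof.
move=> hU [n [v [_ hv]]].
have /choice[a ha] : forall i : 'I_n.+1, exists a : 'I_n -> K, U i = \sum_l a l *: v l.
  by move=> i; have [//|a /eqP] := hv (U i); rewrite subr_eq0 => /eqP; exists a.
pose A : 'M[K]_(n.+1, n) := \matrix_(i, l) a i l.
pose B : 'M[K]_(n, n.+1) := \matrix_(l, j) psi j (val (v l)).
have AB : A *m B = 1%:M.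
  apply/matrixP => i j; rewrite !mxE eq_sym -(hU j i) ha.
  rewrite (raddf_sum (val : sY -> X)) linear_sum /=; apply: eq_bigr => l _.
  by rewrite !mxE linearZ.
have := mulmx1_min AB; rewrite ltnn//.
Qed.

End Main.

(** * The subspace without invariant subsets *)

Section SpanClosure.
Context (R : realType) (k : scalar_kind) (X : topologicalLmodType (scalars R k)).
Local Notation K := (scalars R k).
Variables (p : nat -> X -> R) (hX : is_frechet p).
Variables (J : nat -> nat) (g : nat -> {poly K}) (U : nat -> X).

Let hp := frechet_semi hX.

Definition span_closure_pred : {pred X} := fun x => `[< in_span_closure J g p U x >].

Lemma span_closure_submod : subsemimod_closed span_closure_pred.
Proof.
split; first split.
- apply/asboolP => j d d0; exists 0.
  by rewrite /realize /lcomb size_poly0 big_ord0 subr0 (semi0 (hp j)).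
- move=> x y /asboolP hx /asboolP hy; apply/asboolP => j d d0.
  have [|f hf] := hx j (d / 2); first by rewrite divr_gt0.
  have [|h hh] := hy j (d / 2); first by rewrite divr_gt0.
  exists (f + h); rewrite /realize lcombD opprD addrACA.
  by apply: le_lt_trans (semiD (hp j) _ _) _; rewrite /realize in hf hh; lra.
- move=> a x /asboolP hx; apply/asboolP => j d d0.
  have a1 : 0 < 1 + modulus a by rewrite ltr_pwDl// modulus_ge0.
  have [|f hf] := hx j (d / (1 + modulus a)); first by rewrite divr_gt0.
  exists (a *: f); rewrite /realize lcombZ -scalerBr (semiZ (hp j)).
  rewrite ltr_pdivlMr// in hf; apply: le_lt_trans hf.
  rewrite mulrC ler_wpM2l ?(semi_ge0 (hp j))// lerDr//.
Qed.

HB.instance Definition _ :=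
  GRing.isSubmodClosed.Build K X span_closure_pred span_closure_submod.

Definition span_closure : submodClosed X := span_closure_pred.

Lemma span_closureP x : reflect (in_span_closure J g p U x) (x \in span_closure).
Proof. exact: asboolP. Qed.

Lemma span_closure_closed : closed [set x : X | x \in span_closure].
Proof.
move=> x clx; apply/span_closureP => j d d0.
have d2 : 0 < d / 2 by rewrite divr_gt0.
have [y [/= /span_closureP hy py]] := clx _ (frechet_nbhs hX x j d2).
have [f hf] := hy j _ d2.
exists f; apply: le_lt_trans (semi_tri (hp j) y _ _) _.
by rewrite (semiC (hp j) x y); move: hf py => /=; lra.
Qed.

End SpanClosure.

Theorem corollary3p13 (R : realType) (k : scalar_kind)
    (X : topologicalLmodType (scalars R k)) (p : nat -> X -> R)
    (hX : is_frechet p)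
    (hker : forall j : nat,
      infinite_codim (seminorm_ker (p j.+1)) (seminorm_ker (p j))) :
  ~ hereditary_invariant_subset_property X.
Proof.
have hp := frechet_semi hX.
have mono := frechet_mono hX.
have [e [phi [p_e phi_bound phi_e]]] := biorthogonal_system hp mono hker.
have [J [g tasks]] := tasks_exist R k.
have complete := frechet_seq_complete hX.
have [lam [U [psi [psiU psi_cont psi_lam level_U rows]]]] :=
  realization J g hp complete p_e mono phi_bound phi_e.
pose Y := span_closure hX J g U.
have sep := frechet_separating hX.
have [T0 hT0] := shift_operator hp mono complete psiU psi_lam level_U rows.
have YT (y : subspace_type Y) : T0 (val y) \in Y.
  by apply/span_closureP; have [] := hT0 _ (elimT (span_closureP _ _ _ _ _) (valP y)).
pose T (y : subspace_type Y) : subspace_type Y := Sub (T0 (val y)) (YT y).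
have Yv (y : subspace_type Y) : in_span_closure J g p U (val y).
  exact/(span_closureP hX)/(valP y).
have linT : linear T.
  move=> a x y; apply: val_inj.
  rewrite [LHS]SubK.
  exact: (operator_linear hp sep hT0 (Yv x) (Yv y) (Yv (a *: x + y))).
pose M := GRing.isLinear.Build (scalars R k) _ _ _ T linT.
pose TL : {linear subspace_type Y -> subspace_type Y} := HB.pack T M.
move=> /(_ Y (@span_closure_closed _ _ _ _ hX J g U)).
have iterE m x : val (iter m T x) = iter m T0 (val x) by elim: m => //= m <-.
have YU n : U n \in Y.
  apply/span_closureP; rewrite -(realize_fresh J g U n); exact: span_closure_realize.
have infY : infinite_dimensional (subspace_type Y).
  apply: (@biorthogonal_infinite_dimensional _ _ _ Y (fun n => Sub (U n) (YU n)) psi) => n m.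
  exact: psiU.
move=> /(_ infY TL) [|M' hM'].
  apply: (subspace_continuous hX) => j x y.
  have -> : val (T y) - val (T x) = T0 (val (y - x)).
    by rewrite -[RHS]/(val (TL (y - x))) linearB.
  have := (hT0 _ (Yv (y - x))).2 j 0; rewrite mulr0 /realize /lcomb size_poly0 big_ord0.
  by rewrite !subr0.
apply: (dense_orbits_no_invariant_subset hX (T := T) _ (ex_intro _ M' hM')).
move=> x z j d x0 d0.
have vx0 : val x != 0 by apply: contra_neq x0 => vx; apply: val_inj.
have [m hm] := orbit_dense hp mono sep tasks psiU psi_cont psi_lam level_U rows hT0
  j (Yv x) vx0 (Yv z) d0.
by exists m; rewrite iterE.
Qed.
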